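(* For every $q>0$ and every $x>a_0/\gamma_0$, the Laplace transforms $\widehat Q_i(q,x)=\mathbb E[\exp(-qT(x))\mid \varepsilon(0)=i]$, $i\in\{0,1\}$, of the falling time $T(x)$ are given by $$\widehat Q_0(q,x)=\frac{\lambda_0}{\lambda_0+q}\,F\bigl(b_0(q),b_1(q);\beta_0(q)+1;z(x)\bigr),\qquad \widehat Q_1(q,x)=F\bigl(b_0(q),b_1(q);\beta_0(q);z(x)\bigr),$$ where $$z(x)=\frac{a_0/\gamma_0-x}{a_0/\gamma_0-a_1/\gamma_1},\qquad \beta_0(q)=\frac{\lambda_0+q}{\gamma_0},\qquad \beta_1(q)=\frac{\lambda_1+q}{\gamma_1},$$ $b_0(q)\le b_1(q)$ are the two numbers $$\frac12\left(\beta_0(q)+\beta_1(q)\mp\sqrt{(\beta_0(q)-\beta_1(q))^2+4\beta_0(0)\beta_1(0)}\right),$$ and $F$ is the Gaussian hypergeometric function, given by its power series when $x<2a_0/\gamma_0-a_1/\gamma_1$ and by analytic continuation in $z$ along the negative half-line for larger $x$.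
   Context: Let $\varepsilon=\varepsilon(t)\in\{0,1\}$, $t\ge0$, be a time-homogeneous two-state Markov process with positive switching intensities $\lambda_0,\lambda_1$: $\mathbb P\{\varepsilon(t+dt)=i\mid\varepsilon(t)=i\}=1-\lambda_i\,dt+o(dt)$, $dt\to 0$. Let $a_0,a_1\in\mathbb R$ and $\gamma_0,\gamma_1>0$ with $a_0/\gamma_0>a_1/\gamma_1$. The Ornstein-Uhlenbeck process of bounded variation $X=X(t)$ is the path-continuous solution of $$dX(t)=\bigl(a_{\varepsilon(t)}-\gamma_{\varepsilon(t)}X(t)\bigr)\,dt,\quad t>0,\qquad X(0)=x.$$ For $x>a_0/\gamma_0$ put $T(x)=\inf\{t:\ X(t)<a_0/\gamma_0\}$, where $X(0)=x$, with $\exp(-qT(x))=0$ on $\{T(x)=\infty\}$. The Gaussian hypergeometric function is $F(b_0,b_1;\beta;z)=1+\sum_{n\ge1}\frac{(b_0)_n(b_1)_n}{(\beta)_n\,n!}z^n$ for $|z|<1$, with $(b)_n=b(b+1)\cdots(b+n-1)$, $(b)_0=1$, and is defined by analytic continuation for $z\le-1$. *)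

(* Defs.v *)
From HB Require Import structures.
From mathcomp Require Import all_boot all_order all_algebra.
From mathcomp Require Import all_classical all_reals all_analysis.
Set Implicit Arguments.
Unset Strict Implicit.
Unset Printing Implicit Defensive.
Import Order.TTheory GRing.Theory Num.Theory.
Import numFieldNormedType.Exports.
Local Open Scope classical_set_scope.
Local Open Scope ring_scope.

(* The two states 0 and 1 are encoded as [false] and [true]; processes are
   indexed by all of R but constrained only at times t >= 0. *)

Section TwoStateMarkov.
Context {R : realType} {d : measure_display} {Om : measurableType d}.
Variable P : probability Om R.
Implicit Types (eps : R -> Om -> bool) (A B : set Om).

(* P(A | B), meaningful when P(B) > 0 *)
Definition cond_prob A B : R := fine (P (A `&` B)) / fine (P B).

(* E[Y | B], meaningful when P(B) > 0 *)
Definition cond_expectation (Y : Om -> \bar R) B : \bar R :=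
  ((fine (P B))^-1%:E * \int[P]_(w in B) Y w)%E.

Definition in_state eps (t : R) (i : bool) : set Om := [set w | eps t w = i].

(* natural filtration: the sigma-algebra generated by eps u, 0 <= u <= s *)
Definition past eps (s : R) : set_system Om :=
  <<s [set A | exists u i, 0 <= u <= s /\ A = in_state eps u i] >>.

Record two_state_markov (lam : bool -> R) eps : Prop := TwoStateMarkov {
  tsm_measurable : forall t : R, 0 <= t -> measurable_fun setT (eps t) ;
  (* Right-continuous paths with left limits; bool being discrete, the limits
     are expressed by eventual constancy. *)
  tsm_right_cont : forall w (t : R), 0 <= t ->
    \forall s \near t^'+, eps s w = eps t w ;
  tsm_left_lim : forall w (t : R), 0 < t ->
    exists i, \forall s \near t^'-, eps s w = i ;
  tsm_markov : forall (s t : R) i j A, 0 <= s -> 0 <= t -> past eps s A ->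
    (0 < P (A `&` in_state eps s i))%E ->
    cond_prob (in_state eps (s + t) j) (A `&` in_state eps s i) =
    cond_prob (in_state eps (s + t) j) (in_state eps s i) ;
  tsm_homogeneous : forall (s s' t : R) i j, 0 <= s -> 0 <= s' -> 0 <= t ->
    (0 < P (in_state eps s i))%E -> (0 < P (in_state eps s' i))%E ->
    cond_prob (in_state eps (s + t) j) (in_state eps s i) =
    cond_prob (in_state eps (s' + t) j) (in_state eps s' i) ;
  tsm_intensity : forall (t : R) i, 0 <= t -> (0 < P (in_state eps t i))%E ->
    (fun h : R => cond_prob (in_state eps (t + h) i) (in_state eps t i)) =
    (fun h : R => 1 - lam i * h) +o_ (0^'+) (fun h : R => h)
}.

End TwoStateMarkov.

Section OrnsteinUhlenbeck.
Context {R : realType} {Om : Type}.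
Implicit Types (eps : R -> Om -> bool) (X : R -> Om -> R).

(* Since eps has jumps, the differential equation is the integral equation. *)
Record ou_bounded_variation (a gam : bool -> R) eps (x : R) X : Prop :=
  OUBoundedVariation {
  ou_continuous : forall w, {within `[0, +oo[, continuous (X ^~ w)} ;
  ou_equation : forall w (t : R), 0 <= t ->
    X t w = x + \int[lebesgue_measure]_(s in `[0, t])
                  (a (eps s w) - gam (eps s w) * X s w)
}.

(* +oo when the level is never crossed *)
Definition falling_time X (level : R) (w : Om) : \bar R :=
  ereal_inf [set t%:E | t in [set t : R | 0 <= t /\ X t w < level]].

End OrnsteinUhlenbeck.

Section Hypergeometric.
Context {R : realType}.
Implicit Types (b c z : R) (f : R -> R).

Definition pochhammer b (n : nat) : R := \prod_(i < n) (b + i%:R).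

Definition hypergeom_coef b0 b1 c (n : nat) : R :=
  pochhammer b0 n * pochhammer b1 n / (pochhammer c n * n`!%:R).

Definition hypergeom_series b0 b1 c z : R :=
  limn (pseries (hypergeom_coef b0 b1 c) z).

Definition real_analytic_at f z0 : Prop :=
  exists (u : nat -> R) (r : R), 0 < r /\
    forall z, `|z - z0| < r -> pseries u (z - z0) @ \oo --> f z.

(* Real-analytic on ]-oo, 1[ and equal to the series on ]-1, 1[; by the
   identity theorem this determines f on ]-oo, 1[. *)
Definition hypergeom_continuation b0 b1 c f : Prop :=
  (forall z, z < 1 -> real_analytic_at f z) /\
  (forall z, `|z| < 1 -> f z = hypergeom_series b0 b1 c z).

(* only meaningful for z < 1 *)
Definition hypergeom b0 b1 c : R -> R :=
  xget (hypergeom_series b0 b1 c)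
       [set f | hypergeom_continuation b0 b1 c f].

End Hypergeometric.

Section Coefficients.
Context {R : realType}.
Variables (a gam lam : bool -> R).

Definition beta_par (i : bool) (q : R) : R := (lam i + q) / gam i.

Definition b_discr (q : R) : R :=
  (beta_par false q - beta_par true q) ^+ 2
  + 4 * beta_par false 0 * beta_par true 0.

Definition b0_par (q : R) : R :=
  2^-1 * (beta_par false q + beta_par true q - Num.sqrt (b_discr q)).

Definition b1_par (q : R) : R :=
  2^-1 * (beta_par false q + beta_par true q + Num.sqrt (b_discr q)).

Definition z_par (x : R) : R :=
  (a false / gam false - x) / (a false / gam false - a true / gam true).

End Coefficients.

(* E[exp(-q T) | eps 0 = i]; expeR -oo = 0 covers {T = +oo} when q > 0. *)
Definition laplace_falling_time {R : realType} {d : measure_display}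
    {Om : measurableType d} (P : probability Om R) (eps : R -> Om -> bool)
    (X : R -> Om -> R) (level q : R) (i : bool) : \bar R :=
  cond_expectation P (fun w => expeR (- (q%:E * falling_time X level w))%E)
    (in_state eps 0 i).

(* Main.v *)
Require Import Defs.
From HB Require Import structures.
From mathcomp Require Import all_boot all_order all_algebra.
From mathcomp Require Import all_classical all_reals all_analysis.
From mathcomp Require Import measurable_realfun.
From mathcomp Require Import ring lra.
Import Order.TTheory GRing.Theory Num.Theory.
Import numFieldNormedType.Exports.
Local Open Scope classical_set_scope.
Local Open Scope ring_scope.
Set Implicit Arguments.
Unset Strict Implicit.
Unset Printing Implicit Defensive.

(** In the coordinate z = z_par x the drift of state 0 is - gam 0 * z and that of
    state 1 is gam 1 * (1 - z), so that the level z = 0 can be crossed only in state 1.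
    Conditioning on a short time step, the Laplace transforms u_0, u_1 should
    solve
      - gam 0 * z * u_0' = (q + lam 0) * u_0 - lam 0 * u_1,
      gam 1 * (1 - z) * u_1' = (q + lam 1) * u_1 - lam 1 * u_0,   u_1(0) = 1,
    and the power series solving this at the singular point z = 0 are the two
    hypergeometric series of the theorem.

    Three things make this rigorous.  (1) The analytic continuation exists:
    around every z0 < 0 the system has power series solutions converging up to
    the singularity 0, and uniqueness for linear systems lets one glue them along
    the negative half-line; the identity theorem makes the continuation unique,
    so that [hypergeom] solves the system on the whole of z < 1
    ([hypergeom_solves_system]).  (2) The process is replaced by an Euler scheme of
    mesh h driven by eps at the times k * h.  Only the finite-dimensional Markov
    property is then needed, and the expected discount at the first crossing is
    computed by a backward recursion ([integral_path_discount]).  Since u solves the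
    system, u is a fixed point of this recursion up to o(h), and the discount
    exp(- q * h) makes the recursion a contraction, so the expected discount tends
    to u ([discounted_estimate]).  (3) For every path the Euler scheme converges to X
    ([euler_path_cvg]), because eps is right-continuous.

    The crossing times need not converge on every path: X touches the level
    without crossing it if a jump occurs exactly at the hitting time.  However the
    sampled discount for the level itself is asymptotically at least exp(- q * T),
    and for any strictly lower level at most exp(- q * T) ([falling_discount]).  Fatou's
    lemma on both sides, and continuity of u_1 at the level, then give the
    theorem, without proving that T is measurable. *)

(** * Power series *)

Section PowerSeries.
Context {R : realType}.
Implicit Types (c A B M : nat -> R) (r s x z : R).

(** The radius of convergence is at least r, by Cauchy estimates: stated with bounds on
    the terms rather than with convergence so that it passes to termwise derivatives. *)
Definition radius_ge c r :=
  forall s, 0 < s < r -> exists M : R, forall n, `|c n| * s ^+ n <= M.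

Lemma radius_cvg c r x : radius_ge c r -> `|x| < r -> cvgn (pseries c x).
Proof.
move=> cr xr; pose s := (`|x| + r) / 2.
have xs : `|x| < s by rewrite /s; lra.
have sr : s < r by rewrite /s; lra.
have s0 : 0 < s by rewrite (le_lt_trans _ xs).
have [|M cM] := cr s; first by rewrite s0 sr.
have M0 : 0 <= M by apply: le_trans (cM 0%N); rewrite mulr_ge0 ?exprn_ge0 ?normr_ge0 ?(ltW s0) ?(ltW t0).
apply: normed_cvg.
apply: (@series_le_cvg _ _ (geometric M (`|x| / s))) => [n|n|n|].
- exact: normr_ge0.
- by rewrite /geometric /= mulr_ge0 // exprn_ge0 // divr_ge0 // ltW.
- rewrite /geometric /= normrM normrX expr_div_n mulrA.
  by rewrite ler_pdivlMr ?exprn_gt0 // mulrAC ler_wpM2r ?exprn_ge0.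
- apply: is_cvg_geometric_series.
  by rewrite ger0_norm ?ltr_pdivrMr ?mul1r // divr_ge0 // ltW.
Qed.

Lemma radius_diffs c r : radius_ge c r -> radius_ge (pseries_diffs c) r.
Proof.
move=> cr s /andP[s0 sr]; pose t := (s + r) / 2.
have st : s < t by rewrite /t; lra.
have tr : t < r by rewrite /t; lra.
have t0 : 0 < t by apply: lt_trans st.
have [|M cM] := cr t; first by rewrite t0 tr.
have M0 : 0 <= M by apply: le_trans (cM 0%N); rewrite mulr_ge0 ?exprn_ge0 ?normr_ge0 ?(ltW s0) ?(ltW t0).
pose th := t / s - 1.
have th0 : 0 < th by rewrite /th subr_gt0 ltr_pdivlMr // mul1r.
exists (M / t * (1 + th^-1)) => n.
rewrite /pseries_diffs normrM ger0_norm //.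
have bern : 1 + n%:R * th <= (t / s) ^+ n.
  have -> : t / s = 1 + th by rewrite /th; ring.
  elim: n => [|n IH]; first by rewrite expr0 mul0r addr0.
  rewrite exprS; apply: (@le_trans _ _ ((1 + th) * (1 + n%:R * th))).
    have -> : n.+1%:R = 1 + n%:R :> R by rewrite -natr1 addrC.
    have n0 : 0 <= n%:R :> R by [].
    nra.
  by rewrite ler_pM2l // addr_gt0.
have cn : `|c n.+1| * t ^+ n <= M / t.
  by rewrite ler_pdivlMr // -mulrA -exprSr.
have sn0 : 0 < s ^+ n by rewrite exprn_gt0.
have tn : s ^+ n * (1 + n%:R * th) <= t ^+ n.
  have -> : t ^+ n = s ^+ n * (t / s) ^+ n by rewrite -exprMn mulrC divfK ?gt_eqF.
  by rewrite ler_pM2l.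
have K1 : n.+1%:R <= (1 + th^-1) * (1 + n%:R * th).
  have -> : (1 + th^-1) * (1 + n%:R * th) = n.+1%:R + (n%:R * th + th^-1).
    by rewrite -natr1; field; rewrite gt_eqF.
  rewrite lerDl addr_ge0 // ?invr_ge0 ?mulr_ge0 //; exact: ltW.
have th1 : 0 < 1 + th^-1 by rewrite addr_gt0 // invr_gt0.
apply: (@le_trans _ _ ((1 + th^-1) * (`|c n.+1| * (s ^+ n * (1 + n%:R * th))))).
  have -> : (1 + th^-1) * (`|c n.+1| * (s ^+ n * (1 + n%:R * th)))
    = ((1 + th^-1) * (1 + n%:R * th)) * `|c n.+1| * s ^+ n by ring.
  by rewrite ler_pM2r // ler_wpM2r.
rewrite [leRHS]mulrC ler_pM2l //; apply: le_trans cn.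
by rewrite ler_wpM2l.
Qed.

(** The form in which the recursions below bound their solutions: the ratio of
    consecutive majorants tends to 1 / r. *)
Lemma radius_majorant c M K C r : 0 < r ->
  (forall n, 0 <= M n) -> (forall n, `|c n| <= K * M n) ->
  (forall n, r * n.+1%:R * M n.+1 <= (n%:R + C) * M n) -> radius_ge c r.
Proof.
move=> r0 M0 cM Mrec s /andP[s0 sr].
(* from this index on, M n * s ^+ n decreases *)
pose N := Num.truncn (`|C| * s / (r - s)).
have rs : 0 < r - s by rewrite subr_gt0.
have dec n : (N <= n)%N -> M n.+1 * s ^+ n.+1 <= M n * s ^+ n.
  move=> Nn; rewrite exprS mulrA; apply: ler_wpM2r; first by rewrite exprn_ge0 ?ltW.
  have Cn : C * s <= (n%:R + 1) * (r - s).
    apply: (@le_trans _ _ (`|C| * s)); first by rewrite ler_wpM2r ?ler_norm ?ltW.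
    rewrite -ler_pdivrMr //; apply: ltW; apply: lt_le_trans (truncnS_gt _) _.
    by rewrite natr1 ler_nat ltnS.
  have n0 : 0 < r * n.+1%:R by rewrite mulr_gt0.
  rewrite -(ler_pM2l n0) mulrA.
  apply: le_trans (_ : (n%:R + C) * M n * s <= _); first by rewrite ler_wpM2r ?(ltW s0).
  rewrite mulrAC ler_wpM2r // -natr1; nra.
exists (K * (\sum_(i < N.+1) M i * s ^+ i)) => n.
have sn k : 0 <= s ^+ k by rewrite exprn_ge0 ?ltW.
apply: (@le_trans _ _ (K * (M n * s ^+ n))).
  by rewrite mulrA ler_wpM2r.
have [K0|K0] := leP 0 K; last first.
  have Mz k : M k = 0.
    apply/eqP; rewrite eq_le M0 andbT.
    have := le_trans (normr_ge0 _) (cM k); have := M0 k; nra.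
  by rewrite Mz big1 ?mul0r ?mulr0 // => i _; rewrite Mz mul0r.
rewrite ler_wpM2l //.
have ub k : (k <= N)%N -> M k * s ^+ k <= \sum_(i < N.+1) M i * s ^+ i.
  move=> kN; rewrite (bigD1 (Ordinal (kN : (k < N.+1)%N))) //= lerDl.
  by apply: sumr_ge0 => i _; rewrite mulr_ge0.
have [nN|nN] := leqP n N; first exact: ub.
have : M n * s ^+ n <= M N * s ^+ N.
  have := ltnW nN; rewrite -(subnK (ltnW nN)); move: (n - N)%N => k _.
  elim: k => [//|k IH]; rewrite addSn; apply: le_trans IH.
  by apply: dec; rewrite leq_addl.
by move/le_trans; apply; exact: ub.
Qed.

Lemma is_derive_pseries c r z0 z : radius_ge c r -> `|z - z0| < r ->
  is_derive z 1 (fun y => limn (pseries c (y - z0)))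
    (limn (pseries (pseries_diffs c) (z - z0))).
Proof.
move=> cr zr; pose s := (`|z - z0| + r) / 2.
have zs : `|z - z0| < s by rewrite /s; lra.
have sr : s < r by rewrite /s; lra.
have s0 : 0 < s by rewrite (le_lt_trans _ zs).
have sn : `|s| < r by rewrite gtr0_norm.
have D := @pseries_snd_diffs _ c s (z - z0) (radius_cvg cr sn)
  (radius_cvg (radius_diffs cr) sn) (radius_cvg (radius_diffs (radius_diffs cr)) sn).
have {}D := D (lt_le_trans zs (ler_norm s)).
have H := @is_derive1_comp _ (fun x => limn (pseries c x)) (fun y => y - z0) z _ _ D
  (is_derive_shift z 1 (- z0)).
by apply: (is_derive_eq H); rewrite mulr1.
Qed.

End PowerSeries.

(** Gronwall in both time directions: E(z) exp(- K z) decreases and E(z) exp(K z) increases. *)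
Lemma gronwall_vanish {R : realType} (E dE : R -> R) (K x y : R) : x <= y ->
  (forall z, z \in `[x, y] -> is_derive z 1 E (dE z)) ->
  (forall z, z \in `[x, y] -> `|dE z| <= K * E z) ->
  (E x = 0 -> E y <= 0) /\ (E y = 0 -> E x <= 0).
Proof.
move=> xy DE bE.
pose h (k : R) z := E z * expR (k * z).
have Dh k z : z \in `[x, y] ->
    is_derive z 1 (h k) (expR (k * z) * (dE z + k * E z)).
  move=> zxy; have D1 := DE z zxy.
  have D2 : is_derive z 1 (fun z => expR (k * z)) (expR (k * z) * k).
    have H : is_derive z 1 (fun z : R => k * z) k.
      by apply: is_derive_eq; rewrite /GRing.scale /= mulr1.
    exact: (@is_derive1_comp _ expR _ z _ _ (is_derive_expR _) H).
  have H := is_deriveM D1 D2; apply: (is_derive_eq H).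
  by rewrite /GRing.scale /=; ring.
have drv k z : z \in `]x, y[ -> derivable (h k) z 1.
  by move=> /subset_itv_oo_cc zxy; have [] := Dh k z zxy.
have der k z : z \in `]x, y[ -> derive1 (h k) z = expR (k * z) * (dE z + k * E z).
  by move=> /subset_itv_oo_cc zxy; have H := Dh k z zxy; rewrite derive1E (@derive_val _ _ _ _ _ _ _ H).
have cont k : {within `[x, y], continuous (h k)}.
  by apply: derivable_within_continuous => z zxy; have [] := Dh k z zxy.
split=> E0.
- have : h (- K) y <= h (- K) x.
    apply: (ler0_derive1_nincr (drv _) _ (cont _)) => // z zxy.
    rewrite der // pmulr_rle0 ?expR_gt0 //.
    have := bE z (subset_itv_oo_cc zxy); have := ler_norm (dE z); lra.
  by rewrite /h E0 mul0r pmulr_lle0 // expR_gt0.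
- have : h K x <= h K y.
    apply: (ger0_derive1_ndecr (drv _) _ (cont _)) => // z zxy.
    rewrite der // pmulr_rge0 ?expR_gt0 //.
    have := bE z (subset_itv_oo_cc zxy); have := ler_norm (- dE z); rewrite normrN; lra.
  by rewrite /h E0 mul0r pmulr_lle0 // expR_gt0.
Qed.

(** * The hypergeometric system *)

Section System.
Context {R : realType}.
Variables c bt mu : R.
Implicit Types (A B : nat -> R) (f g : R -> R) (l r m x y z w : R).

(** With c * bt - mu * c = b0 * b1 and c + bt = b0 + b1, the pair
    f = F(b0, b1; c + 1; .), g = F(b0, b1; c; .) solves this first-order form of
    the hypergeometric equation. *)
Definition hypergeom_system f g z := exists df dg : R,
  [/\ is_derive z 1 f df, is_derive z 1 g dg,
      z * df = c * (g z - f z) & (1 - z) * dg = bt * g z - mu * f z].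

(** The system, read on the coefficients of power series centred at z0; the centre 0 is
    allowed, where the first line determines A from B. *)
Definition coef_rec z0 A B := forall n,
  z0 * n.+1%:R * A n.+1 = c * B n - (c + n%:R) * A n /\
  (1 - z0) * n.+1%:R * B n.+1 = (bt + n%:R) * B n - mu * A n.

Lemma cvg_eq_fun (u v : nat -> R) (l : R) : u =1 v -> u @ \oo --> l -> v @ \oo --> l.
Proof. by move=> /funext ->. Qed.

Lemma cvg_pseries_euler A r x : radius_ge A r -> `|x| < r ->
  pseries (fun n => n%:R * A n) x @ \oo --> x * limn (pseries (pseries_diffs A) x).
Proof.
move=> Ar xr.
have := pseries_diffs_equiv (radius_cvg (radius_diffs Ar) xr).
move=> /(cvgMl_tmp (a := x)); apply: cvg_eq_fun => n /=.
rewrite /pseries /series /= mulr_sumr; apply: eq_bigr => i _.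
by case: i => [|i]; rewrite ?mul0r ?mulr0 // exprS /=; ring.
Qed.

Lemma cvg_pseriesD A B x (a b : R) :
  pseries A x @ \oo --> a -> pseries B x @ \oo --> b ->
  pseries (fun n => A n + B n) x @ \oo --> a + b.
Proof.
move=> hA hB; apply: cvg_eq_fun (cvgD hA hB) => n /=.
rewrite fctE /pseries /series /= -big_split /=; apply: eq_bigr => i _.
by rewrite mulrDl.
Qed.

Lemma cvg_pseriesZ A x (a k : R) : pseries A x @ \oo --> a ->
  pseries (fun n => k * A n) x @ \oo --> k * a.
Proof.
move=> hA; apply: cvg_eq_fun (cvgMl_tmp (a := k) hA) => n /=.
rewrite /pseries /series /= mulr_sumr; apply: eq_bigr => i _.
by rewrite mulrA.
Qed.

Lemma series_system z0 A B r z : radius_ge A r -> radius_ge B r ->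
  coef_rec z0 A B -> `|z - z0| < r ->
  hypergeom_system (fun y => limn (pseries A (y - z0))) (fun y => limn (pseries B (y - z0))) z.
Proof.
move=> Ar Br AB zr; exists (limn (pseries (pseries_diffs A) (z - z0))),
  (limn (pseries (pseries_diffs B) (z - z0))).
have SA := radius_cvg Ar zr; have SB := radius_cvg Br zr.
have SdA := radius_cvg (radius_diffs Ar) zr.
have SdB := radius_cvg (radius_diffs Br) zr.
have EA := cvg_pseries_euler Ar zr; have EB := cvg_pseries_euler Br zr.
split; [exact: is_derive_pseries zr|exact: is_derive_pseries zr| |].
- have H1 := cvg_pseriesD (cvg_pseriesZ (k := z0) SdA) EA.
  have H2 := cvg_pseriesZ (k := c) (cvg_pseriesD SB (cvg_pseriesZ (k := -1) SA)).
  have e : (fun n => z0 * pseries_diffs A n + n%:R * A n) =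
           (fun n => c * (B n + -1 * A n)).
    apply/funext => n; rewrite /pseries_diffs mulrA (AB n).1; ring.
  rewrite e in H1; have := cvg_unique _ H1 H2; move=> /(_ (@norm_hausdorff _ _)).
  by move=> E; rewrite mulN1r in E; rewrite -E; ring.
- have H1 := cvg_pseriesD (cvg_pseriesZ (k := 1 - z0) SdB) (cvg_pseriesZ (k := -1) EB).
  have H2 := cvg_pseriesD (cvg_pseriesZ (k := bt) SB) (cvg_pseriesZ (k := - mu) SA).
  have e : (fun n => (1 - z0) * pseries_diffs B n + -1 * (n%:R * B n)) =
           (fun n => bt * B n + - mu * A n).
    apply/funext => n; rewrite /pseries_diffs mulrA (AB n).2; ring.
  rewrite e in H1; have := cvg_unique _ H1 H2; move=> /(_ (@norm_hausdorff _ _)).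
  by move=> E; rewrite -mulNr -E; ring.
Qed.

Lemma system_sub f g f' g' z : hypergeom_system f g z -> hypergeom_system f' g' z ->
  hypergeom_system (fun y => f y - f' y) (fun y => g y - g' y) z.
Proof.
move=> [df [dg [Df Dg Ef Eg]]] [df' [dg' [Df' Dg' Ef' Eg']]].
exists (df - df'), (dg - dg'); split.
- exact: is_deriveB.
- exact: is_deriveB.
- by rewrite mulrBr Ef Ef'; ring.
- by rewrite mulrBr Eg Eg'; ring.
Qed.

Lemma system_near f g f' g' z : (\near z, f z = f' z) -> (\near z, g z = g' z) ->
  hypergeom_system f g z -> hypergeom_system f' g' z.
Proof.
move=> ff gg [df [dg [Df Dg Ef Eg]]]; exists df, dg; split.
- exact: near_eq_is_derive Df.
- exact: near_eq_is_derive Dg.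
- by rewrite -(nbhs_singleton ff) -(nbhs_singleton gg).
- by rewrite -(nbhs_singleton ff) -(nbhs_singleton gg).
Qed.

Hypothesis c_ge0 : 0 <= c.
Hypothesis bt_ge0 : 0 <= bt.
Hypothesis mu_ge0 : 0 <= mu.

(** Energy estimate for E = f^2 + g^2: away from the singular points 0 and 1 the system
    gives |E'| <= K * E. *)
Lemma system_vanish f g (m x y : R) : x <= y -> 0 < m ->
  (forall z, z \in `[x, y] -> m <= `|z| /\ m <= 1 - z) ->
  (forall z, z \in `[x, y] -> hypergeom_system f g z) ->
  (f x = 0 -> g x = 0 -> f y = 0 /\ g y = 0) /\
  (f y = 0 -> g y = 0 -> f x = 0 /\ g x = 0).
Proof.
move=> xy m0 mz sys.
pose E z := f z ^+ 2 + g z ^+ 2.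
have E0 z : f z = 0 -> g z = 0 -> E z = 0.
  by move=> fz gz; rewrite /E fz gz expr0n addr0.
have E0' z : E z <= 0 -> f z = 0 /\ g z = 0.
  move=> Ez; split; apply/eqP; rewrite -sqrf_eq0 eq_le sqr_ge0 andbT;
  apply: le_trans Ez; rewrite /E ?lerDl ?lerDr sqr_ge0 //.
pose dE z := 'D_1 E z.
have key z : z \in `[x, y] -> is_derive z 1 E (dE z) /\
    `|dE z| <= (3 * c + 2 * bt + mu) / m * E z.
  move=> zxy; have [Df [Dg [H1 H2 e1 e2]]] := sys z zxy.
  have H : is_derive z 1 E (2 * f z * Df + 2 * g z * Dg).
    have := is_deriveD (is_deriveX 2 H1) (is_deriveX 2 H2).
    by move=> H; apply: (is_derive_eq H); rewrite /GRing.scale /= !expr1; ring.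
  have e : dE z = 2 * f z * Df + 2 * g z * Dg by rewrite /dE derive_val.
  split; first by rewrite e.
  have [m1 m2] := mz z zxy.
  rewrite mulrAC ler_pdivlMr // e.
  set F := f z in e1 e2 *; set G := g z in e1 e2 *; rewrite /E -/F -/G.
  have FG : 2 * `|F| * `|G| <= F ^+ 2 + G ^+ 2.
    rewrite -[F ^+ 2]real_normK ?num_real // -[G ^+ 2]real_normK ?num_real //.
    have := sqr_ge0 (`|F| - `|G|); rewrite sqrrB; lra.
  have a1 : `|Df| * m <= c * (`|G| + `|F|).
    apply: (@le_trans _ _ (`|Df| * `|z|)); first by rewrite ler_wpM2l.
    rewrite -normrM mulrC e1 normrM ger0_norm // ler_wpM2l //.
    exact: ler_normB.
  have a2 : `|Dg| * m <= bt * `|G| + mu * `|F|.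
    apply: (@le_trans _ _ (`|Dg| * `|1 - z|)).
      by rewrite ler_wpM2l // (le_trans m2) // ler_norm.
    rewrite -normrM mulrC e2; apply: le_trans (ler_normB _ _) _.
    by rewrite !normrM !(ger0_norm bt_ge0) !(ger0_norm mu_ge0).
  apply: (@le_trans _ _ ((2 * `|F| * `|Df| + 2 * `|G| * `|Dg|) * m)).
    rewrite ler_wpM2r ?(ltW m0) //; apply: le_trans (ler_normD _ _) _.
    by rewrite !normrM !(@ger0_norm _ 2).
  have F2 : F ^+ 2 = `|F| ^+ 2 by rewrite real_normK ?num_real.
  have G2 : G ^+ 2 = `|G| ^+ 2 by rewrite real_normK ?num_real.
  rewrite F2 G2 in FG *.
  set P := `|F| in FG a1 a2 *; set Q := `|G| in FG a1 a2 *.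
  have P0 : 0 <= P by rewrite /P.
  have Q0 : 0 <= Q by rewrite /Q.
  have b1 := ler_wpM2l P0 a1; have b2 := ler_wpM2l Q0 a2.
  have c1 := ler_wpM2l c_ge0 FG; have c2 := ler_wpM2l mu_ge0 FG.
  have d1 : 0 <= c * Q ^+ 2 by rewrite mulr_ge0 ?sqr_ge0.
  have d2 : 0 <= bt * P ^+ 2 by rewrite mulr_ge0 ?sqr_ge0.
  rewrite !expr2 in c1 c2 d1 d2 *; lra.
have [g1 g2] := gronwall_vanish xy (fun z h => (key z h).1) (fun z h => (key z h).2).
split=> fx gx; apply: E0'; [apply: g1|apply: g2]; exact: E0.
Qed.

(** The interval must avoid the singular points 0 and 1 of the two equations. *)
Lemma system_unique f g f' g' l r z0 : r <= 0 \/ (0 <= l /\ r <= 1) ->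
  (forall z, l < z < r -> hypergeom_system f g z) -> (forall z, l < z < r -> hypergeom_system f' g' z) ->
  l < z0 < r -> f z0 = f' z0 -> g z0 = g' z0 ->
  forall z, l < z < r -> f z = f' z /\ g z = g' z.
Proof.
move=> lr sys sys' z0lr f0 g0 z zlr.
pose u y := f y - f' y; pose v y := g y - g' y.
have sysd y : l < y < r -> hypergeom_system u v y.
  by move=> h; apply: system_sub; [exact: sys|exact: sys'].
suff : u z = 0 /\ v z = 0 by move=> [/eqP + /eqP]; rewrite !subr_eq0 => /eqP-> /eqP->.
have seg x y : l < x -> y < r -> x <= y -> exists2 m, 0 < m &
    forall w, w \in `[x, y] -> m <= `|w| /\ m <= 1 - w.
  move=> lx yr xy; have [r0|[l0 r1]] := lr.
  - exists (Num.min (- y) 1); first by rewrite lt_min ltr01 andbT; lra.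
    move=> w; rewrite in_itv /= => /andP[xw wy]; rewrite !ge_min; split.
      by apply/orP; left; have := ler_norm (- w); rewrite normrN; lra.
    by apply/orP; right; lra.
  - exists (Num.min x (1 - y)); first by rewrite lt_min; lra.
    move=> w; rewrite in_itv /= => /andP[xw wy]; rewrite !ge_min; split.
      by rewrite (le_trans xw) // ler_norm.
    by apply/orP; right; lra.
have u0 : u z0 = 0 by rewrite /u f0 subrr.
have v0 : v z0 = 0 by rewrite /v g0 subrr.
move: z0lr zlr => /andP[lz0 z0r] /andP[lz zr].
have [zz|zz] := leP z z0.
- have [m m0 mw] := seg z z0 lz z0r zz.
  have [|_] := @system_vanish u v m z z0 zz m0 mw; last exact.
  move=> w; rewrite in_itv /= => /andP[? ?]; apply: sysd; lra.
- have [m m0 mw] := seg z0 z lz0 zr (ltW zz).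
  have [|+ _] := @system_vanish u v m z0 z (ltW zz) m0 mw; last exact.
  move=> w; rewrite in_itv /= => /andP[? ?]; apply: sysd; lra.
Qed.

Fixpoint local_coef (z0 : R) (p : R * R) (n : nat) : R * R :=
  if n is k.+1 then let: (a, b) := local_coef z0 p k in
    ((c * b - (c + k%:R) * a) / (z0 * k.+1%:R),
     ((bt + k%:R) * b - mu * a) / ((1 - z0) * k.+1%:R))
  else p.

(** At a regular centre any initial values extend to a series solution, whose radius
    reaches the nearest singular point. *)
Lemma local_solution z0 (a b : R) : z0 != 0 -> z0 < 1 -> exists A B,
  [/\ A 0%N = a, B 0%N = b, coef_rec z0 A B,
      radius_ge A (Num.min `|z0| (1 - z0)) & radius_ge B (Num.min `|z0| (1 - z0))].
Proof.
move=> z00 z01; pose L := local_coef z0 (a, b).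
pose A n := (L n).1; pose B n := (L n).2.
have AB : coef_rec z0 A B.
  move=> n; rewrite /A /B /L /=; case: (local_coef _ _ n) => x y /=.
  have n0 : n.+1%:R != 0 :> R by rewrite pnatr_eq0.
  have z1 : 1 - z0 != 0 by rewrite subr_eq0 gt_eqF.
  by split; rewrite mulrC divfK // mulf_neq0.
have z10 : 0 < 1 - z0 by rewrite subr_gt0.
set r := Num.min _ _.
have r0 : 0 < r by rewrite lt_min normr_gt0 z00.
have rec n : r * n.+1%:R * (`|A n.+1| + `|B n.+1|) <=
    (n%:R + (c + bt + mu)) * (`|A n| + `|B n|).
  have [e1 e2] := AB n; rewrite mulrDr.
  have n0 : 0 <= n.+1%:R :> R by [].
  have m0 : 0 <= n%:R :> R by [].
  have h1 : r * n.+1%:R * `|A n.+1| <= c * `|B n| + (c + n%:R) * `|A n|.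
    apply: (@le_trans _ _ `|z0 * n.+1%:R * A n.+1|).
      by rewrite !normrM (ger0_norm n0) ler_wpM2r // ler_wpM2r // ge_min lexx.
    rewrite e1; apply: le_trans (ler_normB _ _) _.
    by rewrite !normrM (ger0_norm c_ge0) (ger0_norm (addr_ge0 c_ge0 m0)).
  have h2 : r * n.+1%:R * `|B n.+1| <= (bt + n%:R) * `|B n| + mu * `|A n|.
    apply: (@le_trans _ _ `|(1 - z0) * n.+1%:R * B n.+1|).
      rewrite !normrM (ger0_norm n0) (gtr0_norm z10) ler_wpM2r // ler_wpM2r //.
      by rewrite ge_min lexx orbT.
    rewrite e2; apply: le_trans (ler_normB _ _) _.
    by rewrite !normrM (ger0_norm mu_ge0) (ger0_norm (addr_ge0 bt_ge0 m0)).
  have := mulr_ge0 bt_ge0 (normr_ge0 (A n)); have := mulr_ge0 mu_ge0 (normr_ge0 (B n)).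
  lra.
have majorant C : (forall n, `|C n| <= `|A n| + `|B n|) -> radius_ge C r.
  move=> AC; apply: (@radius_majorant _ C (fun n => `|A n| + `|B n|) 1 _ _ r0 _ _ rec).
    by move=> n; rewrite addr_ge0.
  by move=> n; rewrite mul1r.
exists A, B; split=> //; apply: majorant => n; rewrite ?lerDl ?lerDr //.
Qed.

Lemma lim_pseries0 A : limn (pseries A 0) = A 0%N.
Proof.
have : pseries A 0 @ \oo --> A 0%N.
  rewrite -cvg_shiftS; apply: cvg_near_cst; near=> n.
  rewrite /pseries /series /= big_nat_recl // expr0 mulr1 big1 ?addr0 // => i _.
  by rewrite expr0n mulr0.
by move/cvg_lim; apply; exact: norm_hausdorff.
Unshelve. all: by end_near. Qed.

(** A solution coincides around each regular point with a power series solution, hence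
    is analytic there. *)
Lemma system_local f g z0 l : z0 != 0 -> l < z0 < 1 ->
  (forall z, l < z < 1 -> hypergeom_system f g z) ->
  exists A B, let r := Num.min `|z0| (1 - z0) in
  [/\ radius_ge A r, radius_ge B r,
      forall z, `|z - z0| < r -> hypergeom_system (fun y => limn (pseries A (y - z0)))
                                     (fun y => limn (pseries B (y - z0))) z &
      forall z, l < z -> `|z - z0| < r ->
      f z = limn (pseries A (z - z0)) /\ g z = limn (pseries B (z - z0))].
Proof.
move=> z00 /andP[lz0 z01] sys.
have [A [B [A0 B0 AB rA rB]]] := local_solution (f z0) (g z0) z00 z01.
exists A, B => /=; set r := Num.min _ _ in rA rB *.
have loc z : `|z - z0| < r -> hypergeom_system (fun y => limn (pseries A (y - z0)))
                                     (fun y => limn (pseries B (y - z0))) z.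
  by move=> zr; apply: series_system zr.
split=> // z lz zr.
have rz : r <= `|z0| by rewrite ge_min lexx.
have r1 : r <= 1 - z0 by rewrite ge_min lexx orbT.
have r0 : 0 < r by rewrite lt_min normr_gt0 z00 subr_gt0.
have itv w : Num.max l (z0 - r) < w < z0 + r -> l < w /\ `|w - z0| < r.
  rewrite gt_max => /andP[/andP[h1 h2] h3]; split=> //.
  by rewrite ltr_distlC; apply/andP; split; lra.
apply: (@system_unique f g (fun y => limn (pseries A (y - z0)))
  (fun y => limn (pseries B (y - z0))) (Num.max l (z0 - r)) (z0 + r) z0).
- have [zneg|zpos] := ltrP z0 0.
    by left; have := ltr0_norm zneg; lra.
  right; split; last by lra.
  by rewrite le_max; apply/orP; right; rewrite subr_ge0 -(ger0_norm zpos).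
- by move=> w /itv [h1 h2]; apply: sys; move: h2; rewrite ltr_distlC; lra.
- by move=> w /itv [h1 h2]; exact: loc.
- by rewrite gt_max lz0 /=; lra.
- by rewrite subrr lim_pseries0.
- by rewrite subrr lim_pseries0.
- by rewrite gt_max lz /=; move: zr; rewrite ltr_distlC; lra.
Qed.

Variables A0 B0 : nat -> R.
Hypothesis rA0 : radius_ge A0 1.
Hypothesis rB0 : radius_ge B0 1.
Hypothesis AB0 : coef_rec 0 A0 B0.

Definition extends_series l f g :=
  (forall z, l < z < 1 -> hypergeom_system f g z) /\
  (forall z, `|z| < 1 -> f z = limn (pseries A0 z) /\ g z = limn (pseries B0 z)).

Lemma extends_series_start :
  extends_series (-1) (fun z => limn (pseries A0 z)) (fun z => limn (pseries B0 z)).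
Proof.
split=> // z z1; have zr : `|z - 0| < 1 by rewrite subr0 ltr_norml.
have := series_system rA0 rB0 AB0 zr.
by under [X in hypergeom_system X _]funext do rewrite subr0;
   under [X in hypergeom_system _ X]funext do rewrite subr0.
Qed.

Lemma extends_series_unique l l' f g f' g' z :
  extends_series l f g -> extends_series l' f' g' -> l < z -> l' < z -> z < 1 ->
  f z = f' z /\ g z = g' z.
Proof.
move=> [sys ser] [sys' ser'] lz lz' z1.
have [zs|zs] := ltP (-1) z.
  have zn : `|z| < 1 by rewrite ltr_norml zs.
  by have [-> ->] := ser z zn; have [-> ->] := ser' z zn.
have h1 : `|- 2^-1 : R| < 1 by rewrite normrN ger0_norm //; lra.
have [e1 e2] := ser _ h1; have [e1' e2'] := ser' _ h1.
apply: (@system_unique f g f' g' (Num.max l l') 0 (- 2^-1)).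
- by left.
- by move=> w; rewrite gt_max => h; apply: sys; lra.
- by move=> w; rewrite gt_max => h; apply: sys'; lra.
- by rewrite gt_max; lra.
- by rewrite e1 e1'.
- by rewrite e2 e2'.
- by rewrite gt_max; lra.
Qed.

(** The series centred at - (3/4) r converges as far as - (3/2) r and agrees with the
    given solution on ]-r, 0[, so it prolongs it. *)
Lemma extends_series_step f g r : 1 <= r -> extends_series (- r) f g ->
  exists f' g', extends_series (- (3 / 2 * r)) f' g'.
Proof.
move=> r1 [sys ser]; pose z0 : R := - (3 / 4 * r).
have z00 : z0 != 0 by rewrite /z0 lt_eqF //; lra.
have [|A [B [rA rB loc eqs]]] := system_local z00 _ sys; first by rewrite /z0; lra.
have nz0 : `|z0| = 3 / 4 * r by rewrite /z0 normrN ger0_norm //; lra.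
have rE : Num.min `|z0| (1 - z0) = 3 / 4 * r.
  by rewrite nz0; apply/min_idPl; rewrite /z0; lra.
rewrite rE in rA rB loc eqs.
have itv z : - (3 / 2 * r) < z < 0 -> `|z - z0| < 3 / 4 * r.
  by rewrite ltr_distlC /z0; lra.
pose f' z := if z < z0 then limn (pseries A (z - z0)) else f z.
pose g' z := if z < z0 then limn (pseries B (z - z0)) else g z.
have fg z : - r < z -> f' z = f z /\ g' z = g z.
  move=> rz; rewrite /f' /g'; case: ifP => // zz0.
  have [|-> -> //] := eqs z rz; apply: itv; rewrite /z0 in zz0; lra.
exists f', g'; split; last first.
  move=> z z1; have [|-> ->] := fg z; last exact: ser.
  by move: z1; rewrite ltr_norml; lra.
move=> z zr; have [rz|rz] := ltP (- r) z.
  apply: (@system_near f g); last by apply: sys; lra.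
  - by near=> w; have [|-> _ //] := fg w; near: w; exact: lt_nbhsr.
  - by near=> w; have [|_ -> //] := fg w; near: w; exact: lt_nbhsr.
have zz0 : z < z0 by rewrite /z0; lra.
apply: system_near (loc z (itv _ _)); last by lra.
- by near=> w; rewrite /f' ifT //; near: w; exact: lt_nbhsl.
- by near=> w; rewrite /g' ifT //; near: w; exact: lt_nbhsl.
Unshelve. all: by end_near. Qed.

(** Uniqueness makes the successive prolongations coherent, so that they glue to one pair
    of functions on ]-oo, 1[. *)
Lemma extends_series_all : exists f g, forall l, extends_series l f g.
Proof.
have pow n : 1 <= (3 / 2) ^+ n :> R by apply: exprn_ege1; lra.
have [F FP] : exists F : nat -> (R -> R) * (R -> R),
    forall n, extends_series (- (3 / 2) ^+ n) (F n).1 (F n).2.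
  have /choice [F FP] : forall n, exists fg, extends_series (- (3 / 2) ^+ n) fg.1 fg.2.
    elim=> [|n [[f g] /= IH]].
      by eexists (_, _); rewrite expr0; exact: extends_series_start.
    have [f' [g' fg']] := extends_series_step (pow n) IH.
    by exists (f', g'); rewrite exprS.
  by exists F.
have big z : exists n, - (3 / 2) ^+ n < z.
  have bern n : 1 + n%:R * 2^-1 <= (3 / 2) ^+ n :> R.
    elim: n => [|n IH]; first by rewrite mul0r addr0 expr0.
    have n0 : 0 <= n%:R :> R by [].
    by rewrite exprS -natr1; lra.
  exists (Num.truncn `|2 * z|).+1.
  have := truncnS_gt `|2 * z|; have := bern (Num.truncn `|2 * z|).+1.
  by have := ler_norm (- (2 * z)); rewrite normrN; lra.
have /choice [N NP] := big.
exists (fun z => (F (N z)).1 z), (fun z => (F (N z)).2 z).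
have agree n z : - (3 / 2) ^+ n < z -> z < 1 ->
    (F (N z)).1 z = (F n).1 z /\ (F (N z)).2 z = (F n).2 z.
  by move=> nz z1; exact: (extends_series_unique (FP (N z)) (FP n)).
move=> l; split=> [z /andP[_ z1]|z z1]; last exact: (FP (N z)).2.
have sys := (FP (N z)).1 z.
have nr : \forall w \near z, - (3 / 2) ^+ N z < w /\ w < 1.
  by near=> w; split; near: w; [apply: lt_nbhsr; rewrite NP|exact: lt_nbhsl].
apply: system_near (sys _); last by rewrite NP.
- by apply: filterS nr => w [h1 h2]; have [-> _] := agree _ _ h1 h2.
- by apply: filterS nr => w [h1 h2]; have [_ ->] := agree _ _ h1 h2.
Unshelve. all: by end_near. Qed.

Lemma real_analytic_pseries A r z0 f : 0 < r -> radius_ge A r ->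
  (forall z, `|z - z0| < r -> f z = limn (pseries A (z - z0))) ->
  real_analytic_at f z0.
Proof.
by move=> r0 rA fA; exists A, r; split=> // z zr; rewrite fA //; exact: radius_cvg zr.
Qed.

Lemma extends_analytic f g z : (forall l, extends_series l f g) -> z < 1 ->
  real_analytic_at f z /\ real_analytic_at g z.
Proof.
move=> fg z1; have [->|z0] := eqVneq z 0.
  by split; [apply: (real_analytic_pseries ltr01 rA0)|apply: (real_analytic_pseries ltr01 rB0)]
   => w; rewrite subr0 => w1; have [] := (fg 0).2 w w1.
have [||A [B [rA rB _ eqs]]] := @system_local f g z (z - `|z| - 1) z0.
- by rewrite z1 andbT; have := normr_ge0 z; lra.
- by move=> w; exact: (fg _).1.
have r0 : 0 < Num.min `|z| (1 - z) by rewrite lt_min normr_gt0 z0 subr_gt0.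
have rz : Num.min `|z| (1 - z) <= `|z| by rewrite ge_min lexx.
have lw w : `|w - z| < Num.min `|z| (1 - z) -> z - `|z| - 1 < w.
  by rewrite ltr_distlC; lra.
split; [apply: (real_analytic_pseries r0 rA)|apply: (real_analytic_pseries r0 rB)]
  => w wz; by have [] := eqs w (lw w wz) wz.
Qed.

End System.

(** * Identity theorem and the continued hypergeometric function *)

Section IdentityTheorem.
Context {R : realType}.
Implicit Types (u v : nat -> R) (f g : R -> R) (r t z : R).

Lemma pseries_zero u r : 0 < r ->
  (forall t, 0 < t < r -> pseries u t @ \oo --> (0 : R)) -> forall n, u n = 0.
Proof.
move=> r0; have zero w : (forall t, 0 < t < r -> pseries w t @ \oo --> (0 : R)) ->
    w 0%N = 0.
  move=> w0; have ru : radius_ge w r.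
    move=> s sr; have [K [_ KP]] := cvg_series_bounded (cvgP _ (w0 s sr)).
    exists (K + 1) => k; have := KP (K + 1); rewrite ltrDl ltr01 => /(_ isT k).
    by move=> /(_ I) /=; rewrite normrM normrX (gtr0_norm (andP sr).1).
  have D := @is_derive_pseries _ w r 0 0 ru; rewrite subrr normr0 in D.
  have cont : {for 0, continuous (fun y => limn (pseries w (y - 0)))}.
    apply: differentiable_continuous; apply/derivable1_diffP.
    by have [] := D r0.
  have : limn (pseries w (y - 0)) @[y --> 0^'+] --> limn (pseries w (0 - 0)).
    exact: cvg_at_right_filter.
  rewrite subrr lim_pseries0 => H.
  have H0 : limn (pseries w (y - 0)) @[y --> 0^'+] --> (0 : R).
    apply: cvg_near_cst; near=> y; rewrite subr0.
    apply: cvg_lim; first exact: norm_hausdorff.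
    by apply: w0; apply/andP; split; near: y; [exact: nbhs_right_gt|exact: nbhs_right_lt].
  exact: cvg_unique H H0.
move=> + n; elim: n u => [|n IH] u u0; first exact: zero.
have u00 := zero u u0.
apply: (IH (fun k => u k.+1)) => t tr.
have t0 : t != 0 by rewrite gt_eqF //; case/andP: tr.
have := u0 t tr; rewrite -cvg_shiftS => /(cvgMl_tmp (a := t^-1)); rewrite mulr0.
apply: cvg_eq_fun => k; rewrite /pseries /series /= big_nat_recl // u00 mul0r add0r.
rewrite mulr_sumr; apply: eq_bigr => i _; rewrite exprS; field.
Unshelve. all: by end_near. Qed.

(** Two such functions agree to the right of s, the supremum of the points where they
    differ; their expansions at s then have equal coefficients, so they agree also to the
    left of s. *)
Lemma analytic_identity f g z :
  (forall z, z < 1 -> real_analytic_at f z) -> (forall z, z < 1 -> real_analytic_at g z) ->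
  (forall z, `|z| < 1 -> f z = g z) -> z < 1 -> f z = g z.
Proof.
move=> af ag fg z1; apply/eqP; apply: contrapT => /negP fgz.
pose B : set R := [set w | w < 1 /\ f w != g w].
have Bub w : B w -> w <= -1.
  move=> [w1 fgw]; rewrite leNgt; apply/negP => w2; move/negP: fgw; apply.
  by apply/eqP/fg; rewrite ltr_norml w2.
have Bz : B z by split.
have supB : has_sup B by split; [exists z|exists (-1) => w /Bub].
pose s := sup B.
have s1 : s <= -1 by apply: ge_sup => //; exists z.
have above w : s < w -> w < 1 -> f w = g w.
  move=> sw w1; apply/eqP; apply: contrapT => /negP fgw.
  have : w <= s by apply: sup_upper_bound.
  by rewrite leNgt sw.
have s1' : s < 1 by lra.
have [u [r [r0 fu]]] := af s s1'; have [v [r' [r0' gv]]] := ag s s1'.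
pose m := Num.min (Num.min r r') 1.
have m0 : 0 < m by rewrite !lt_min r0 r0' ltr01.
have mr : m <= r /\ m <= r' /\ m <= 1 by rewrite !ge_min !lexx !orbT.
have uv n : u n - v n = 0.
  apply: (@pseries_zero (fun n => u n - v n) m m0) => t /andP[t0 tm].
  have ht : `|(s + t) - s| = t by rewrite addrC addKr gtr0_norm.
  have H1 := fu (s + t); rewrite ht in H1.
  have H2 := gv (s + t); rewrite ht in H2.
  have ts : s + t - s = t by ring.
  rewrite ts in H1 H2.
  have H3 := cvg_pseriesD (H1 _) (cvg_pseriesZ (k := -1) (H2 _)).
  have := H3 _ _; rewrite above; [|lra|lra]; rewrite mulN1r subrr.
  move=> H; apply: cvg_eq_fun (H _ _) => [k|//|//]; try lra.
  by congr (pseries _ t k); apply/funext => i; rewrite mulN1r.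
have [w Bw sw] := sup_adherent m0 supB.
have ws : w <= s by apply: sup_upper_bound.
case: Bw => w1 /eqP; apply.
have sw' : s - m < w := sw.
have wr : `|w - s| < m by rewrite ler0_norm ?subr_le0 //; lra.
have H1 := fu w (lt_le_trans wr mr.1); have H2 := gv w (lt_le_trans wr mr.2.1).
have uve : u = v by apply/funext => n; apply/eqP; rewrite -subr_eq0 uv.
rewrite uve in H1; exact: cvg_unique H1 H2.
Qed.

End IdentityTheorem.

Section HypergeometricSystem.
Context {R : realType}.
Variables c bt mu b0 b1 : R.
Hypothesis c_gt0 : 0 < c.
Hypothesis bt_ge0 : 0 <= bt.
Hypothesis mu_ge0 : 0 <= mu.
Hypothesis bD : b0 + b1 = c + bt.
Hypothesis bM : b0 * b1 = c * bt - mu * c.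

Lemma pochhammerS (b : R) n : pochhammer b n.+1 = pochhammer b n * (b + n%:R).
Proof. by rewrite /pochhammer big_ord_recr. Qed.

Lemma pochhammer_gt0 (b : R) n : 0 < b -> 0 < pochhammer b n.
Proof. by move=> b_gt0; apply: prodr_gt0 => i _; rewrite ltr_wpDr. Qed.

Lemma pochhammer_shift (b : R) n : b * pochhammer (b + 1) n = pochhammer b n * (b + n%:R).
Proof.
elim: n => [|n IH]; first by rewrite /pochhammer !big_ord0 mulr1 mul1r addr0.
by rewrite !pochhammerS mulrA IH -natr1; ring.
Qed.

Let A n := hypergeom_coef b0 b1 (c + 1) n.
Let B n := hypergeom_coef b0 b1 c n.

Lemma hypergeom_coef_shift n : c * B n = (c + n%:R) * A n.
Proof.
have c1 : 0 < c + 1 by rewrite addr_gt0.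
have n0 : 0 <= n%:R :> R by [].
have := pochhammer_shift c n.
rewrite /A /B /hypergeom_coef; set P := pochhammer b0 n; set Q := pochhammer (c + 1) n.
set p := pochhammer c n => e.
have p0 : p != 0 by rewrite gt_eqF ?pochhammer_gt0.
have Q0 : Q != 0 by rewrite gt_eqF ?pochhammer_gt0.
have f0 : n`!%:R != 0 :> R by rewrite pnatr_eq0 -lt0n fact_gt0.
have cn : c + n%:R != 0 by rewrite gt_eqF // ltr_wpDr.
apply: (mulIf (mulf_neq0 (mulf_neq0 p0 Q0) f0)).
transitivity (P * pochhammer b1 n * (c * Q)); first by field; rewrite p0 f0.
by rewrite e; field; rewrite Q0 f0.
Qed.

(** This is where b0 and b1 enter: (b0 + n) * (b1 + n) = (bt + n) * (c + n) - mu * c. *)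
Lemma hypergeom_coefS n : n.+1%:R * B n.+1 = (bt + n%:R) * B n - mu * A n.
Proof.
have n0 : 0 <= n%:R :> R by [].
have cn : c + n%:R != 0 by rewrite gt_eqF // ltr_wpDr.
apply: (mulfI cn).
have -> : (c + n%:R) * ((bt + n%:R) * B n - mu * A n) = (b0 + n%:R) * (b1 + n%:R) * B n.
  transitivity ((c + n%:R) * (bt + n%:R) * B n - mu * ((c + n%:R) * A n)); first by ring.
  rewrite -hypergeom_coef_shift.
  have -> : (b0 + n%:R) * (b1 + n%:R) = b0 * b1 + (b0 + b1) * n%:R + n%:R ^+ 2 by ring.
  by rewrite bM bD; ring.
have P0 : pochhammer c n != 0 by rewrite gt_eqF ?pochhammer_gt0.
have f0 : n`!%:R != 0 :> R by rewrite pnatr_eq0 -lt0n fact_gt0.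
have f1 : n.+1%:R != 0 :> R by rewrite pnatr_eq0.
rewrite /B /hypergeom_coef !pochhammerS factS natrM; field.
by rewrite P0 f0 cn nat1r f1.
Qed.

Lemma hypergeom_coef_rec : coef_rec c bt mu 0 A B.
Proof.
move=> n; split; first by rewrite !mul0r hypergeom_coef_shift subrr.
by rewrite subr0 mul1r hypergeom_coefS.
Qed.

Lemma hypergeom_coef_le n : `|A n| <= `|B n|.
Proof.
have n0 : 0 <= n%:R :> R by [].
rewrite -(ler_pM2l c_gt0); apply: (@le_trans _ _ ((c + n%:R) * `|A n|)).
  by rewrite ler_wpM2r // lerDl.
have cn : 0 <= c + n%:R by rewrite addr_ge0 // ltW.
by rewrite -{1}(ger0_norm cn) -normrM -hypergeom_coef_shift normrM gtr0_norm.
Qed.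

Let radius_coef C : (forall n, `|C n| <= `|B n|) -> radius_ge C 1.
Proof.
move=> CB; apply: (@radius_majorant _ C (fun n => `|B n|) 1 (bt + mu) 1) => // n.
  by rewrite mul1r.
have n0 : 0 <= n%:R :> R by [].
rewrite mul1r -[n.+1%:R]ger0_norm // -normrM hypergeom_coefS.
apply: le_trans (ler_normB _ _) _.
rewrite (normrM _ (B n)) (normrM mu) (ger0_norm mu_ge0) (ger0_norm (addr_ge0 bt_ge0 n0)).
have := ler_wpM2l mu_ge0 (hypergeom_coef_le n).
move: (`|A n|) (`|B n|) => x y; lra.
Qed.

Let rA : radius_ge A 1. Proof. exact/radius_coef/hypergeom_coef_le. Qed.
Let rB : radius_ge B 1. Proof. exact: radius_coef. Qed.

(** By the identity theorem, any continuation is the one picked by [hypergeom]. *)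
Lemma hypergeomP (b0' b1' c' : R) f : hypergeom_continuation b0' b1' c' f ->
  forall z, z < 1 -> hypergeom b0' b1' c' z = f z.
Proof.
move=> [af fE] z z1.
have [ah hE] : hypergeom_continuation b0' b1' c' (hypergeom b0' b1' c').
  by rewrite /hypergeom; case: xgetP => [g -> //|/(_ f)]; case.
by apply: analytic_identity => // w w1; rewrite hE // fE.
Qed.

Lemma hypergeom_solves_system z : z < 1 ->
  hypergeom_system c bt mu (hypergeom b0 b1 (c + 1)) (hypergeom b0 b1 c) z.
Proof.
move=> z1; have [f [g fg]] := extends_series_all (ltW c_gt0) bt_ge0 mu_ge0 rA rB
  hypergeom_coef_rec.
have an w := @extends_analytic _ c bt mu (ltW c_gt0) bt_ge0 mu_ge0 A B rA rB f g w fg.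
have Hf : hypergeom_continuation b0 b1 (c + 1) f.
  by split=> w w1; [have [] := an w w1|have [] := (fg 0).2 w w1].
have Hg : hypergeom_continuation b0 b1 c g.
  by split=> w w1; [have [] := an w w1|have [] := (fg 0).2 w w1].
have [sys _] := fg (z - 1).
apply: system_near (sys z _); last by rewrite z1 andbT; lra.
- by near=> w; rewrite (hypergeomP Hf) //; near: w; exact: lt_nbhsl.
- by near=> w; rewrite (hypergeomP Hg) //; near: w; exact: lt_nbhsl.
Unshelve. all: by end_near. Qed.

Lemma hypergeom0 : hypergeom b0 b1 c 0 = 1.
Proof.
have [f [g fg]] := extends_series_all (ltW c_gt0) bt_ge0 mu_ge0 rA rB hypergeom_coef_rec.
have an w := @extends_analytic _ c bt mu (ltW c_gt0) bt_ge0 mu_ge0 A B rA rB f g w fg.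
have Hg : hypergeom_continuation b0 b1 c g.
  by split=> w w1; [have [] := an w w1|have [] := (fg 0).2 w w1].
rewrite (hypergeomP Hg) // Hg.2 ?normr0 // /hypergeom_series lim_pseries0.
by rewrite /hypergeom_coef /pochhammer !big_ord0 fact0 !mulr1 divr1.
Qed.

End HypergeometricSystem.

(** * Discounted crossing of the Euler chain *)

Lemma uniformly_continuous_segment {R : realType} (f : R -> R) (x0 x1 e : R) : 0 < e ->
  (forall x, x0 <= x <= x1 -> {for x, continuous f}) ->
  exists2 r, 0 < r & forall x y, x0 <= x <= x1 -> `|y - x| < r -> `|f y - f x| < e.
Proof.
move=> e0 cf.
have := @segment_compact R x0 x1; rewrite compact_near_coveringP => /(_ R (0^'+)
  (fun r x => forall y, `|y - x| < r -> `|f y - f x| < e)) H.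
have {}H : \forall r \near 0^'+, forall x, x0 <= x <= x1 ->
    forall y, `|y - x| < r -> `|f y - f x| < e.
  near=> r => x xx; move: x xx.
  suff : `[x0, x1] `<=` (fun x => forall y, `|y - x| < r -> `|f y - f x| < e).
    by move=> S x xx; apply: S; rewrite /= in_itv.
  near: r; apply: H => x; rewrite /= in_itv /= => xx.
  have e2 : 0 < e / 2 by rewrite divr_gt0.
  have /cvgrPdist_lt /(_ _ e2) /nbhs_ballP [d /= d0 dP] := cf x xx.
  have d2 : 0 < d / 2 by rewrite divr_gt0.
  exists (ball x (d / 2), [set r | r < d / 2]).
    split; first exact: nbhsx_ballx.
    exact: nbhs_right_lt.
  move=> [x' r] [/= xx' rd] y yx'.
  have h1 : `|f x - f x'| < e / 2.
    by apply: dP; apply: lt_le_trans xx' _; lra.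
  have h2 : `|f x - f y| < e / 2.
    apply: dP; rewrite /ball /=; rewrite /ball /= in xx'.
    have -> : x - y = (x - x') - (y - x') by ring.
    apply: le_lt_trans (ler_normB _ _) _; lra.
  have -> : f y - f x' = (f x - f x') - (f x - f y) by ring.
  apply: le_lt_trans (ler_normB _ _) _; lra.
have [r [r0 rP]] : exists r : R, 0 < r /\ forall x, x0 <= x <= x1 ->
    forall y, `|y - x| < r -> `|f y - f x| < e.
  near (0 : R)^'+ => r; exists r; split; near: r; last exact: H.
  exact: nbhs_right_gt.
by exists r => // x y xx; exact: rP.
Unshelve. all: by end_near. Qed.

Section EulerChain.
Context {R : realType}.
Variables (lam a gam : bool -> R) (q : R).
Hypothesis lam_gt0 : forall i, 0 < lam i.
Hypothesis gam_gt0 : forall i, 0 < gam i.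
Hypothesis rho_lt : a true / gam true < a false / gam false.
Hypothesis q_gt0 : 0 < q.

Local Notation rho0 := (a false / gam false).
Local Notation rho1 := (a true / gam true).

Definition euler (h : R) (j : bool) (x : R) : R := x + h * (a j - gam j * x).

(** Backward recursion for the expected discount expR (- q * h * l), l the first index
    at which the Euler chain started from state i and position x is below lev, and 0 if
    there is no such l <= k. The chain moves with the state reached at the end of each
    step, and p i is the probability that the state i is the same after one step. *)
Fixpoint discounted (p : bool -> R) (h lev : R) (k : nat) (i : bool) (x : R) : R :=
  if x < lev then 1 else
  if k is k'.+1 then expR (- (q * h)) *
    (p i * discounted p h lev k' i (euler h i x)
     + (1 - p i) * discounted p h lev k' (~~ i) (euler h (~~ i) x))
  else 0.

(** If v satisfies the recursion up to h * eta, and is within th of 1 after a crossing, the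
    error contracts by expR (- q * h) at each step; summing the geometric series of the
    local errors costs h * eta / (1 - expR (- q * h)), which is at most 2 * eta / q. *)
Lemma discounted_contraction (v : bool -> R -> R) p (h lev x0 C D th eta : R) :
  0 < h -> q * h <= 1 -> 0 <= th -> 0 <= eta -> 0 <= C -> 2 * eta <= q * D ->
  (forall i, 0 <= p i <= 1) ->
  (forall i x, lev <= x <= x0 -> `|v i x| <= C) ->
  (forall j x, lev <= x <= x0 -> euler h j x <= x0 /\
     (euler h j x < lev -> `|1 - v j (euler h j x)| <= th)) ->
  (forall i x, lev <= x <= x0 ->
     `|expR (- (q * h)) * (p i * v i (euler h i x) + (1 - p i) * v (~~ i) (euler h (~~ i) x))
       - v i x| <= h * eta) ->
  forall k i x, lev <= x <= x0 ->
  `|discounted p h lev k i x - v i x| <= C * expR (- (q * h)) ^+ k + th + D.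
Proof.
move=> h0 qh th0 eta0 C0 etaD p01 vC succ resid.
set rho := expR (- (q * h)).
have rpos : 0 < rho by rewrite expR_gt0.
have qh0 : 0 < q * h by rewrite mulr_gt0.
have rle1 : rho <= 1 by rewrite expR_le1 oppr_le0 ltW.
have D0 : 0 <= D by rewrite -(pmulr_rge0 _ q_gt0); apply: le_trans etaD; rewrite mulr_ge0.
(* D absorbs one more local error: it dominates the sum of the geometric series *)
have rhoD : rho * D + h * eta <= D.
  have : rho * (1 + q * h) <= 1.
    rewrite /rho expRN mulrC ler_pdivrMr ?expR_gt0 // mul1r; exact: expR_ge1Dx.
  have := ler_wpM2l (ltW h0) etaD.
  have : q * h * rho <= q * h by rewrite ler_piMr // ltW.
  move=> h1 h2 h3.
  have h4 : q * h / 2 <= 1 - rho by nra.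
  have := ler_wpM2r D0 h4; nra.
elim=> [|k IH] i x xl; rewrite /= ltNge (proj1 (andP xl)) /=.
  rewrite sub0r normrN expr0 mulr1; have := vC i x xl; lra.
set B := C * rho ^+ k + th + D in IH.
have err j : `|discounted p h lev k j (euler h j x) - v j (euler h j x)| <= B.
  have [e1 e2] := succ j x xl.
  have [yl|yl] := ltP (euler h j x) lev.
    have -> : discounted p h lev k j (euler h j x) = 1 by case: (k) => /= *; rewrite yl.
    have Ck : 0 <= C * rho ^+ k := mulr_ge0 C0 (exprn_ge0 k (ltW rpos)).
    by apply: le_trans (e2 yl) _; rewrite /B; lra.
  by apply: IH; rewrite yl.
have [p0 p1] := andP (p01 i).
have := err i; have := err (~~ i).
set d1 := discounted _ _ _ _ _ _; set d0 := discounted _ _ _ _ _ _ => E1 E0.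
set w1 := v (~~ i) _ in E1 *; set w0 := v i (euler _ _ _) in E0 *.
have -> : rho * (p i * d0 + (1 - p i) * d1) - v i x =
  rho * (p i * (d0 - w0) + (1 - p i) * (d1 - w1)) +
  (rho * (p i * w0 + (1 - p i) * w1) - v i x) by ring.
apply: le_trans (ler_normD _ _) _.
have S : `|p i * (d0 - w0) + (1 - p i) * (d1 - w1)| <= B.
  apply: le_trans (ler_normD _ _) _.
  rewrite !normrM (ger0_norm p0) (@ger0_norm _ (1 - p i)) ?subr_ge0 //.
  have := ler_wpM2l p0 E0; have : 0 <= 1 - p i by rewrite subr_ge0.
  move=> /ler_wpM2l /(_ _ _ E1); lra.
rewrite normrM (gtr0_norm rpos).
have := resid i x xl; rewrite -/rho -/w1 -/w0 => r1.
have := ler_wpM2l (ltW rpos) S; rewrite /B exprS => r2.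
have : rho * th <= th by rewrite ler_piMl.
lra.
Qed.

Variable v : bool -> R -> R.
Hypothesis v_sol : forall i x, rho1 < x -> exists2 d, is_derive x 1 (v i) d &
  (a i - gam i * x) * d = (q + lam i) * v i x - lam i * v (~~ i) x.
Hypothesis v_level : v true rho0 = 1.

(** By the equation of v, this is the derivative of v i along the drift of state i; unlike
    the derivative of v i itself it has no singular denominator at the fixed point of the
    drift. *)
Definition generator_value i (x : R) := (q + lam i) * v i x - lam i * v (~~ i) x.
Local Notation V := generator_value.

Lemma v_continuous i x : rho1 < x -> {for x, continuous (v i)}.
Proof.
move=> xr; have [d [D _] _] := v_sol i xr.
by apply: differentiable_continuous; apply/derivable1_diffP.
Qed.

Lemma rho_le i : rho1 <= a i / gam i <= rho0.
Proof. by case: i; rewrite lexx ?(ltW rho_lt). Qed.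

Lemma euler_toward (h : R) j x : 0 < h -> h * gam j <= 1 ->
  (x <= a j / gam j -> x <= euler h j x <= a j / gam j) /\
  (a j / gam j <= x -> a j / gam j <= euler h j x <= x).
Proof.
move=> h0 hg; have -> : euler h j x = x + h * gam j * (a j / gam j - x).
  by rewrite /euler; field; rewrite gt_eqF.
have g0 : 0 < h * gam j by rewrite mulr_gt0.
move: (a j / gam j) (h * gam j) hg g0 => r g g1 g0.
by split=> xr; apply/andP; split; nra.
Qed.

Lemma euler_gt (h : R) j x : 0 < h -> h * gam j <= 2^-1 -> rho1 < x -> rho1 < euler h j x.
Proof.
move=> h0 hg x1; have g0 : 0 < h * gam j by rewrite mulr_gt0.
have -> : euler h j x = x + h * gam j * (a j / gam j - x).
  by rewrite /euler; field; rewrite gt_eqF.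
have /andP[r1 _] := rho_le j.
move: (a j / gam j) (h * gam j) hg g0 r1 => r g g1 g0 r1; nra.
Qed.

(** At an intermediate point xi of the step, h * drift(x) * v'(xi) differs from
    h * drift(xi) * v'(xi) = h * V(xi) only by the factor 1 - s * h * gam i. *)
Lemma euler_increment (h : R) i (x K om r B : R) : 0 < h -> h * gam i <= 2^-1 -> rho1 < x ->
  `|a i - gam i * x| <= B -> h * B < r ->
  `|V i x| <= K -> (forall y, `|y - x| < r -> `|V i y - V i x| <= om) ->
  `|v i (euler h i x) - v i x - h * V i x| <= h * (2 * (h * gam i) * (K + om) + om).
Proof.
move=> h0 hg x1 wB hB VK Vom.
set w := a i - gam i * x in wB; pose y := euler h i x.
have yE : y = x + h * w by [].
have g0 : 0 < h * gam i by rewrite mulr_gt0.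
have y1 : rho1 < y by exact: euler_gt.
have B0 : 0 <= B by apply: le_trans wB.
have om0 : 0 <= om.
  have : `|V i x - V i x| <= om.
    by apply: Vom; rewrite subrr normr0; apply: le_lt_trans hB; exact: mulr_ge0 (ltW h0) B0.
  by rewrite subrr normr0.
have K0 : 0 <= K by apply: le_trans VK.
have [w0|w0] := eqVneq w 0.
  have [d _ e] := v_sol i x1.
  have -> : V i x = 0 by rewrite /V -e -/w w0 mul0r.
  rewrite -/y yE w0 !mulr0 addr0 !subrr normr0.
  have := mulr_ge0 (ltW g0) (addr_ge0 K0 om0) => e1.
  by apply: mulr_ge0; [exact: ltW|apply: addr_ge0 => //; lra].
(* the mean value theorem, in the form: a point at a fraction s of the step *)
have [s [s01 [d [eVd ed]]]] : exists s, 0 <= s <= 1 /\ exists d,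
    (a i - gam i * (x + s * (h * w))) * d = V i (x + s * (h * w)) /\
    v i y - v i x = d * (h * w).
  have mvt x' y' : rho1 < x' -> x' < y' -> exists c d,
      x' < c < y' /\ (a i - gam i * c) * d = V i c /\ v i y' - v i x' = d * (y' - x').
    move=> x1' xy'.
    pose dv (z : R) := xget 0 [set d : R | is_derive z 1 (v i) d /\ (a i - gam i * z) * d = V i z].
    have dvP z : rho1 < z -> is_derive z 1 (v i) (dv z) /\ (a i - gam i * z) * dv z = V i z.
      move=> z1; rewrite /dv; case: xgetP => [d _ //|no].
      by have [d D e] := v_sol i z1; case: (no d).
    have [|c|c cxy e] := @MVT R (v i) dv x' y' xy'.
    - by move=> c; rewrite in_itv /= => /andP[cx _]; have [] := dvP c (lt_trans x1' cx).
    - apply: derivable_within_continuous => z; rewrite in_itv /= => /andP[xz _].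
      by have [[]] := dvP z (lt_le_trans x1' xz).
    move: cxy; rewrite in_itv /= => cxy; exists c, (dv c); split=> //; split=> //.
    by have [] := dvP c _; first by apply: lt_trans x1' _; case/andP: cxy.
  have hw0 : h * w != 0 by rewrite mulf_neq0 // gt_eqF.
  have [wp|wn] := ltP 0 w.
  - have hwp : 0 < h * w by rewrite mulr_gt0.
    have [|c [d [/andP[c1 c2] [e1 e2]]]] := mvt x y x1; first by rewrite yE; lra.
    exists ((c - x) / (h * w)); split.
      rewrite ler_pdivlMr // ler_pdivrMr // mul0r mul1r; rewrite yE in c2; lra.
    exists d; rewrite divfK //; have -> : x + (c - x) = c by ring.
    by split=> //; rewrite e2 yE; ring.
  - have hwn : h * w < 0 by rewrite pmulr_rlt0 // lt_neqAle w0.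
    have [|c [d [/andP[c1 c2] [e1 e2]]]] := mvt y x y1; first by rewrite yE; lra.
    exists ((c - x) / (h * w)); split.
      rewrite ler_ndivlMr // ler_ndivrMr // mul0r mul1r; rewrite yE in c1; lra.
    exists d; rewrite divfK //; have -> : x + (c - x) = c by ring.
    by split=> //; rewrite -opprB e2 yE; ring.
set xi := x + s * (h * w) in eVd.
have [s0 s1] := andP s01.
have Vxi : `|V i xi - V i x| <= om.
  apply: Vom; rewrite /xi addrC addKr !normrM (ger0_norm s0) (gtr0_norm h0).
  apply: le_lt_trans hB; have hw : h * `|w| <= h * B by rewrite ler_pM2l.
  by apply: le_trans hw; rewrite ler_piMl // mulr_ge0 // ltW.
have eV : w * d * (1 - s * (h * gam i)) = V i xi by rewrite -eVd /xi /w; ring.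
have sg0 : 0 <= s * (h * gam i) by rewrite mulr_ge0 // ltW.
have sg1 : s * (h * gam i) <= h * gam i by rewrite ler_piMl // ltW.
have wd : `|w * d| <= 2 * `|V i xi|.
  rewrite -eV (normrM (w * d)) (@ger0_norm _ (1 - _)); last by lra.
  by have := normr_ge0 (w * d); nra.
have VxiK : `|V i xi| <= K + om.
  have -> : V i xi = V i x + (V i xi - V i x) by ring.
  by apply: le_trans (ler_normD _ _) _; exact: lerD.
rewrite -/y ed.
have -> : d * (h * w) - h * V i x =
  h * (w * d * (s * (h * gam i)) + (V i xi - V i x)) by rewrite -eV; ring.
rewrite normrM (gtr0_norm h0) ler_pM2l //.
apply: le_trans (ler_normD _ _) _; apply: lerD => //.
rewrite normrM (ger0_norm sg0).
have b1 : `|w * d| <= 2 * (K + om) by lra.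
have := ler_pM (normr_ge0 _) sg0 b1 sg1; lra.
Qed.

(** The terms of order 1 and h cancel by the equation of v: what remains is of order h
    times the modulus of continuity om, the error kap on the switching probability, and h. *)
Lemma euler_residual (h : R) (p : bool -> R) i (x K om r B kap : R) :
  0 < h -> (forall j, h * gam j <= 2^-1) -> rho1 < x ->
  (forall j, `|a j - gam j * x| <= B) -> h * B < r ->
  (forall j, `|v j x| <= K) -> (forall j y, `|y - x| < r -> `|v j y - v j x| <= om) ->
  `|p i - (1 - lam i * h)| <= kap * h ->
  `|expR (- (q * h)) * (p i * v i (euler h i x) + (1 - p i) * v (~~ i) (euler h (~~ i) x))
     - v i x| <=
  h * (2 * (h * gam i) * ((q + 2 * lam i) * (K + om)) + (q + 2 * lam i) * om
       + 2 * lam i * om + kap * (2 * K + 2 * om) + K * q ^+ 2 * h).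
Proof.
move=> h0 hg x1 wB hB vK vom pi.
have l0 : 0 <= lam i by exact: ltW.
have q0 : 0 <= q by exact: ltW.
have step j : `|euler h j x - x| < r.
  rewrite /euler addrC addKr normrM (gtr0_norm h0).
  by apply: le_lt_trans hB; rewrite ler_pM2l.
have V_sub y z : V i y - V i z =
    (q + lam i) * (v i y - v i z) - lam i * (v (~~ i) y - v (~~ i) z).
  by rewrite /V; ring.
have VK : `|V i x| <= (q + 2 * lam i) * K.
  apply: le_trans (ler_normB _ _) _; rewrite !normrM (ger0_norm l0) ger0_norm ?addr_ge0 //.
  have := ler_wpM2l (addr_ge0 q0 l0) (vK i); have := ler_wpM2l l0 (vK (~~ i)); lra.
have Vom y : `|y - x| < r -> `|V i y - V i x| <= (q + 2 * lam i) * om.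
  move=> yx; rewrite V_sub; apply: le_trans (ler_normB _ _) _.
  rewrite !normrM (ger0_norm l0) ger0_norm ?addr_ge0 //.
  have := ler_wpM2l (addr_ge0 q0 l0) (vom i y yx).
  have := ler_wpM2l l0 (vom (~~ i) y yx); lra.
have := euler_increment h0 (hg i) x1 (wB i) hB VK Vom.
set e1 := v i (euler h i x) - v i x - h * V i x; rewrite -mulrDr => E1.
have E2 := vom i _ (step i); have E3 := vom (~~ i) _ (step (~~ i)).
pose e3 := (v (~~ i) (euler h (~~ i) x) - v (~~ i) x) - (v i (euler h i x) - v i x).
have e3om : `|e3| <= 2 * om by apply: le_trans (ler_normB _ _) _; lra.
pose ep := p i - (1 - lam i * h).
set rho := expR _.
have -> : rho * (p i * v i (euler h i x) + (1 - p i) * v (~~ i) (euler h (~~ i) x)) - v i x =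
   rho * (e1 + lam i * h * e3 - ep * (v (~~ i) x - v i x + e3))
   + v i x * (rho * (1 + q * h) - 1).
  by rewrite /e1 /e3 /ep /V; ring.
have qh0 : 0 < q * h by rewrite mulr_gt0.
have rho0 : 0 < rho by rewrite expR_gt0.
have rho1 : rho <= 1 by rewrite expR_le1 oppr_le0 ltW.
have rhoge : 1 - q * h <= rho by have := expR_ge1Dx (- (q * h)); rewrite -/rho; lra.
have rhole : rho * (1 + q * h) <= 1.
  by rewrite /rho expRN mulrC ler_pdivrMr ?expR_gt0 // mul1r; exact: expR_ge1Dx.
have sq : `|rho * (1 + q * h) - 1| <= (q * h) ^+ 2.
  rewrite ler0_norm ?subr_le0 //.
  have : (1 - q * h) * (1 + q * h) <= rho * (1 + q * h) by rewrite ler_wpM2r //; lra.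
  by rewrite expr2; lra.
apply: le_trans (ler_normD _ _) _; rewrite !normrM (gtr0_norm rho0).
set S := `|e1 + _ - _|.
have SB : S <= h * (2 * (h * gam i) * ((q + 2 * lam i) * (K + om)) + (q + 2 * lam i) * om)
    + lam i * h * (2 * om) + kap * h * (2 * K + 2 * om).
  apply: le_trans (ler_normB _ _) _; apply: lerD.
    apply: le_trans (ler_normD _ _) _; apply: lerD => //.
    rewrite !normrM (ger0_norm l0) (gtr0_norm h0).
    by apply: ler_wpM2l e3om; rewrite mulr_ge0 // ltW.
  rewrite normrM; apply: ler_pM => //.
  apply: le_trans (ler_normD _ _) _; apply: lerD => //.
  apply: le_trans (ler_normB _ _) _; have := vK i; have := vK (~~ i); lra.
have S0 : 0 <= S by rewrite /S.
have : rho * S <= S by rewrite ler_piMl.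
have := ler_pM (normr_ge0 _) (normr_ge0 _) (vK i) sq.
rewrite exprMn => a1 a2.
have -> : K * q ^+ 2 * h = (K * (q ^+ 2 * h ^+ 2)) / h by field; rewrite gt_eqF.
rewrite [leRHS]mulrDr [h * (_ / h)]mulrC divfK ?gt_eqF //.
apply: lerD => //; apply: le_trans a2 _; apply: le_trans SB _.
by rewrite le_eqVlt; apply/orP; left; apply/eqP; ring.
Qed.

(** Lowering the level to rho0 - del changes the boundary value v true rho0 = 1 only by the
    modulus of continuity of v true; state false pushes the chain back to rho0, so that no
    value of v false is needed at a crossing. *)
Lemma discounted_estimate (x0 : R) : exists C : R, forall eta : R, 0 < eta ->
  exists2 e : R, 0 < e & forall (h del : R) (p : bool -> R), 0 < h < e -> 0 <= del < e ->
  (forall i, 0 <= p i <= 1 /\ `|p i - (1 - lam i * h)| <= e * h) ->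
  forall k i x, rho0 - del <= x <= x0 -> rho0 <= x0 ->
  `|discounted p h (rho0 - del) k i x - v i x| <= C * expR (- (q * h)) ^+ k + eta.
Proof.
have rho_lt' := rho_lt; have q0 := q_gt0; pose l := (rho0 + rho1) / 2.
have l1 : rho1 < l by rewrite /l; lra.
have l0 : l < rho0 by rewrite /l; lra.
have [x0r|x0r] := ltP x0 rho0.
  by exists 0 => eta _; exists 1 => // *; exfalso; lra.
have cv j x : l <= x <= x0 -> {for x, continuous (v j)}.
  by move=> /andP[lx _]; apply: v_continuous; exact: lt_le_trans lx.
have [C Cv] : exists C : R, forall j x, l <= x <= x0 -> `|v j x| <= C.
  have lx0 : l <= x0 by lra.
  have cont : {within `[l, x0], continuous (fun x => `|v false x| + `|v true x|)}.
    apply: continuous_in_subspaceT => x /set_mem /=; rewrite in_itv /= => xl.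
    have c1 := cv false x xl; have c2 := cv true x xl.
    by apply: cvgD; apply: cvg_norm.
  have [c _ cP] := EVT_max lx0 cont.
  exists (`|v false c| + `|v true c|) => j x xl.
  apply: le_trans (cP x _); last by rewrite in_itv.
  by case: j; rewrite ?lerDl ?lerDr.
have C0 : 0 <= C by apply: le_trans (Cv true rho0 _) => //; lra.
exists C => eta eta0.
pose ls := lam false + lam true; pose gs := gam false + gam true.
have lsi i : lam i <= ls by rewrite /ls; case: i; rewrite ?lerDl ?lerDr ltW.
have gsi i : gam i <= gs by rewrite /gs; case: i; rewrite ?lerDl ?lerDr ltW.
have ls0 : 0 < ls by rewrite addr_gt0.
have gs0 : 0 < gs by rewrite addr_gt0.
pose B := \sum_(j : bool) (`|a j| + gam j * (`|l| + `|x0|)).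
have wB j x : l <= x <= x0 -> `|a j - gam j * x| <= B.
  move=> xl; apply: (@le_trans _ _ (`|a j| + gam j * (`|l| + `|x0|))).
    apply: le_trans (ler_normB _ _) _; rewrite lerD2l normrM (gtr0_norm (gam_gt0 j)).
    rewrite ler_pM2l // ler_norml.
    have := ler_norm (- l); have := ler_norm x0; rewrite normrN.
    by have := normr_ge0 l; have := normr_ge0 x0; lra.
  rewrite /B (bigD1 j) //= lerDl sumr_ge0 // => k _.
  by rewrite addr_ge0 // mulr_ge0 ?addr_ge0 // ltW.
have B0 : 0 <= B by apply: le_trans (wB true rho0 _) => //; lra.
pose eta' := q * eta / 4.
have eta'0 : 0 < eta' by rewrite divr_gt0 // mulr_gt0.
pose L := q + 2 * ls.
have L0 : 0 < L by rewrite addr_gt0 // mulr_gt0.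
(* M collects the coefficients of om, of e and of h in [euler_residual] *)
pose M := L + 2 * ls + (2 * C + 2) + (2 * gs * (L * (C + 1)) + C * q ^+ 2).
have M0 : 0 < M.
  have := mulr_gt0 gs0 L0; have := mulr_ge0 C0 (sqr_ge0 q).
  move=> h1 h2; have := mulr_ge0 (ltW h2) C0; rewrite /M; lra.
pose om := Num.min (Num.min 1 (eta / 2)) (eta' / M).
have om0 : 0 < om by rewrite !lt_min ltr01 (divr_gt0 eta0) // (divr_gt0 eta'0).
have [om1 om2 om3] : [/\ om <= 1, om <= eta / 2 & om * M <= eta'].
  by split; rewrite -?ler_pdivlMr // /om !ge_min lexx ?orbT.
clearbody om.
have unif j : exists2 r, 0 < r & forall x y, l <= x <= x0 -> `|y - x| < r ->
    `|v j y - v j x| < om by apply: uniformly_continuous_segment => // x; exact: cv.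
have [r1 r10 r1P] := unif false; have [r2 r20 r2P] := unif true.
pose r := Num.min r1 r2.
have r0 : 0 < r by rewrite lt_min r10.
have vom j x y : l <= x <= x0 -> `|y - x| < r -> `|v j y - v j x| <= om.
  by rewrite lt_min => xl /andP[h1 h2]; apply: ltW; case: j; [exact: r2P|exact: r1P].
clearbody r.
pose e := Num.min (Num.min (Num.min om (q^-1)) ((2 * gs)^-1)) (Num.min (r / 2 / (B + 1)) (Num.min (r / 2) (rho0 - l))).
have e0 : 0 < e.
  have r20' : 0 < r / 2 by rewrite divr_gt0.
  have B1 : 0 < B + 1 by lra.
  rewrite !lt_min om0 !invr_gt0 q_gt0 r20' (divr_gt0 r20' B1) subr_gt0 l0.
  by rewrite (mulr_gt0 _ gs0).
have [e1 e2 e3] : [/\ e <= om, e * q <= 1 & e * (2 * gs) <= 1].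
  by split; rewrite -?ler_pdivlMr ?mulr_gt0 // ?div1r /e !ge_min lexx ?orbT.
have [e4 e5 e6] : [/\ e * (B + 1) <= r / 2, e <= r / 2 & e <= rho0 - l].
  by split; rewrite -?ler_pdivlMr ?ltr_wpDl // /e !ge_min lexx ?orbT.
clearbody e.
exists e => // h del p /andP[h0 he] /andP[d0 de] pP k i x xl _.
have seg y : rho0 - del <= y <= x0 -> l <= y <= x0 by lra.
have hgj j : h * gam j <= 2^-1.
  have := ler_wpM2l (ltW h0) (gsi j); have : h * gs <= e * gs by rewrite ler_pM2r // ltW.
  lra.
have hB : h * B <= r / 2.
  have : h * B <= e * B by rewrite ler_wpM2r // ltW.
  lra.
have hBr : h * B < r by lra.
have := @discounted_contraction v p h (rho0 - del) x0 C (eta / 2) (eta / 2) eta'.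
have -> : C * expR (- (q * h)) ^+ k + eta = C * expR (- (q * h)) ^+ k + eta / 2 + eta / 2.
  by field.
apply=> //.
- have : q * h <= q * e by rewrite ler_pM2l // ltW.
  lra.
- lra.
- exact: ltW.
- by rewrite /eta'; lra.
- by move=> j; have [] := pP j.
- by move=> j y /seg; exact: Cv.
- clear om3 eta'0 M0 L0 lsi gsi ls0 gs0 C0 e2 e3 e4 pP.
  move=> j y yl; have yl' := seg y yl.
  have hg1 : h * gam j <= 1 by have := hgj j; lra.
  have [t1 t2] := euler_toward y h0 hg1.
  have /andP[s1 s2] := rho_le j.
  split.
    have [yr|/ltW yr] := leP y (a j / gam j).
      by have := t1 yr; lra.
    by have := t2 yr; lra.
  move=> elow; have jE : j = true.
    case: j elow t1 t2 {s1 s2 hg1} => // elow t1 t2.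
    have [yr|/ltW yr] := leP y rho0.
      by have := t1 yr; lra.
    by have := t2 yr; lra.
  rewrite jE distrC -[X in _ - X]v_level; apply: le_trans om2.
  apply: vom; first by rewrite x0r (ltW l0).
  rewrite jE in elow.
  have : `|euler h true y - y| <= r / 2.
    rewrite /euler addrC addKr normrM (gtr0_norm h0); apply: le_trans hB.
    by rewrite ler_pM2l //; exact: wB.
  rewrite ler_norml ltr_norml; lra.
- clear om2 e2 e3 e4 e5 e6 hB.
  move=> j y /seg yl.
  have y1 : rho1 < y := lt_le_trans l1 (proj1 (andP yl)).
  apply: le_trans (euler_residual h0 hgj y1 (fun j => wB j y yl) hBr (fun j => Cv j y yl)
    (fun j z => vom j y z yl) (proj2 (pP j))) _.
  rewrite ler_pM2l //; apply: le_trans om3.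
  have hom : h <= om := le_trans (ltW he) e1.
  have Lj : q + 2 * lam j <= L by rewrite /L; have := lsi j; lra.
  have Lj0 : 0 <= q + 2 * lam j by have := lam_gt0 j; lra.
  have gj0 := ltW (gam_gt0 j).
  have a1 : 2 * (h * gam j) * ((q + 2 * lam j) * (C + om)) <= om * (2 * gs * (L * (C + 1))).
    have -> : om * (2 * gs * (L * (C + 1))) = 2 * (om * gs) * (L * (C + 1)) by ring.
    apply: ler_pM.
    - by rewrite !mulr_ge0 // ltW.
    - by rewrite mulr_ge0 // addr_ge0 // ltW.
    - by rewrite ler_pM2l //; apply: ler_pM => //; exact: ltW.
    - by apply: ler_pM => //; rewrite ?addr_ge0 ?lerD2l // ltW.
  have a2 : (q + 2 * lam j) * om <= L * om by rewrite ler_pM2r.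
  have a3 : 2 * lam j * om <= 2 * ls * om by rewrite ler_pM2r // ler_pM2l.
  have a4 : e * (2 * C + 2 * om) <= om * (2 * C + 2).
    apply: ler_pM; [exact: ltW|by rewrite addr_ge0 // mulr_ge0 // ltW|exact: e1|rewrite lerD2l].
    by rewrite ler_piMr.
  have a5 : C * q ^+ 2 * h <= C * q ^+ 2 * om by rewrite ler_wpM2l // mulr_ge0 // sqr_ge0.
  rewrite /M; lra.
Qed.

End EulerChain.

(** * Expectation over the Markov chain sampled on a grid *)

(** The pathwise counterpart of [discounted]: n counts the steps already done, and the
    state used in the next step is e ((n + 1) * h). *)
Fixpoint path_discount {R : realType} (q : R) (a gam : bool -> R) (e : R -> bool)
    (h lev : R) (k n : nat) (x : R) : R :=
  if x < lev then 1 else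
  if k is k'.+1 then expR (- (q * h)) *
    path_discount q a gam e h lev k' n.+1 (euler a gam h (e (n.+1%:R * h)) x)
  else 0.

Section MarkovChain.
Context {R : realType} {d : measure_display} {Om : measurableType d}.
Variable P : probability Om R.
Variables (lam : bool -> R) (eps : R -> Om -> bool).
Hypothesis lam_gt0 : forall i, 0 < lam i.
Hypothesis heps : two_state_markov P lam eps.

Lemma measurable_in_state t i : 0 <= t -> measurable (in_state eps t i).
Proof.
move=> t0; have := tsm_measurable heps t0 measurableT (Y := [set i]) I.
by rewrite setTI.
Qed.

Lemma past_measurable s A : past eps s A -> measurable A.
Proof.
apply: smallest_sub; first exact: sigma_algebra_measurable.
by move=> B [u [i [/andP[u0 _] ->]]]; exact: measurable_in_state.
Qed.

Lemma past_le s t A : s <= t -> past eps s A -> past eps t A.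
Proof.
move=> st; apply: smallest_sub; first exact: smallest_sigma_algebra.
move=> B [u [i [/andP[u0 us] ->]]]; apply: sub_sigma_algebra.
by exists u, i; rewrite u0 (le_trans us st).
Qed.

Lemma past_setI s A B : past eps s A -> past eps s B -> past eps s (A `&` B).
Proof.
by move=> pA pB; apply: (@measurableI _ (g_sigma_algebraType
  [set C | exists u i, 0 <= u <= s /\ C = in_state eps u i])).
Qed.

Lemma past_in_state s t i : 0 <= s <= t -> past eps t (in_state eps s i).
Proof. by move=> st; apply: sub_sigma_algebra; exists s, i. Qed.

(** A state that is never visited with positive probability has no transition probability
    determined by the process; any function with the right intensity serves for it. *)
Lemma transition_kernel : exists p : bool -> R -> R,
  [/\ forall i h, 0 <= h -> 0 <= p i h <= 1,
      forall k : R, 0 < k -> exists2 e : R, 0 < e &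
        forall i h, 0 < h < e -> `|p i h - (1 - lam i * h)| <= k * h &
      forall i s h A, 0 <= s -> 0 <= h -> past eps s A ->
        P (A `&` in_state eps s i `&` in_state eps (s + h) i) =
        ((p i h)%:E * P (A `&` in_state eps s i))%E].
Proof.
pose visited i s := 0 <= s /\ (0 < P (in_state eps s i))%E.
(* an event of probability zero satisfies the identity for any p *)
have null i s h A (p : R) : 0 <= s -> 0 <= h -> past eps s A ->
    P (A `&` in_state eps s i) = 0%E ->
    P (A `&` in_state eps s i `&` in_state eps (s + h) i) =
    (p%:E * P (A `&` in_state eps s i))%E.
  move=> s0 h0 /past_measurable mA z; rewrite z mule0.
  apply/eqP; rewrite eq_le measure_ge0 andbT -z.
  have mI := measurable_in_state i s0.
  have mJ := measurable_in_state i (addr_ge0 s0 h0).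
  apply: le_measure; rewrite ?inE; [|exact: measurableI|exact: subIsetl].
  by apply: measurableI => //; exact: measurableI.
have one i : exists p : R -> R,
  [/\ forall h, 0 <= h -> 0 <= p h <= 1,
      forall k : R, 0 < k -> exists2 e : R, 0 < e &
        forall h, 0 < h < e -> `|p h - (1 - lam i * h)| <= k * h &
      forall s h A, 0 <= s -> 0 <= h -> past eps s A ->
        P (A `&` in_state eps s i `&` in_state eps (s + h) i) =
        ((p h)%:E * P (A `&` in_state eps s i))%E].
  have [[s0 [s00 s0P]]|never] := pselect (exists s, visited i s); last first.
    exists (fun h => expR (- (lam i * h))); split.
    - by move=> h h0; rewrite expR_ge0 expR_le1 oppr_le0 mulr_ge0 // ltW.
    - move=> k k0; exists (k / lam i ^+ 2); first by rewrite divr_gt0 // exprn_gt0.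
      move=> h /andP[h0 hk]; have t0 : 0 < lam i * h by rewrite mulr_gt0.
      have e1 := expR_ge1Dx (- (lam i * h)).
      have e2 : expR (- (lam i * h)) * (1 + lam i * h) <= 1.
        by rewrite expRN mulrC ler_pdivrMr ?expR_gt0 // mul1r; exact: expR_ge1Dx.
      have e3 : (lam i * h) ^+ 2 <= k * h.
        rewrite ltr_pdivlMr ?exprn_gt0 // in hk; rewrite exprMn.
        by have := ler_wpM2r (ltW h0) (ltW hk); rewrite !expr2; lra.
      rewrite ger0_norm; last by lra.
      move: (lam i * h) (expR _) t0 e1 e2 e3 => t E t0 e1 e2; rewrite expr2 => e3.
      nra.
    - move=> s h A s_ge0 h0 pA; apply: null => //.
      apply/eqP; rewrite eq_le measure_ge0 andbT leNgt; apply/negP => pos.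
      apply: never; exists s; split => //; apply: lt_le_trans pos _.
      have mI := measurable_in_state i s_ge0.
      apply: le_measure; rewrite ?inE; [|exact: mI|exact: subIsetr].
      by apply: measurableI => //; exact: past_measurable pA.
  exists (fun h => cond_prob P (in_state eps (s0 + h) i) (in_state eps s0 i)).
  have mI0 := measurable_in_state i s00.
  have fP B : measurable B -> P B \is a fin_num by move=> mB; exact: fin_num_measure.
  split.
  - move=> h h0; have mJ := measurable_in_state i (addr_ge0 s00 h0).
    rewrite /cond_prob; have pos : 0 < fine (P (in_state eps s0 i)).
      by rewrite fine_gt0 // s0P ltey_eq fP ?orbT.
    rewrite divr_ge0 ?fine_ge0 //= ler_pdivrMr // mul1r.
    have mIJ := measurableI _ _ mJ mI0.
    apply: fine_le; rewrite ?fP //; by apply: le_measure; rewrite ?inE //; exact: subIsetr.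
  - move=> k k0; have := tsm_intensity heps s00 s0P.
    move=> /eqaddoP /(_ k k0) [e /= e0 eP]; exists e => // h /andP[h0 he].
    have := eP h; rewrite /ball_ /= sub0r normrN (gtr0_norm h0) => /(_ he h0).
    by rewrite !fctE.
  - move=> s h A s_ge0 h0 pA; have [z|nz] := eqVneq (P (A `&` in_state eps s i)) 0%E.
      exact: null.
    have pos : (0 < P (A `&` in_state eps s i))%E by rewrite lt_neqAle eq_sym nz measure_ge0.
    have mA := past_measurable pA.
    have mI := measurable_in_state i s_ge0.
    have posI : (0 < P (in_state eps s i))%E.
      have mAI' := measurableI _ _ mA mI.
      apply: lt_le_trans pos _.
      by apply: le_measure; rewrite ?inE //; exact: subIsetr.
    rewrite -(tsm_homogeneous heps i s_ge0 s00 h0 posI s0P) -(tsm_markov heps i s_ge0 h0 pA pos).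
    have mAI := measurableI _ _ mA mI.
    have mJ := measurable_in_state i (addr_ge0 s_ge0 h0).
    rewrite /cond_prob -[P (A `&` in_state eps s i)]fineK ?fP // -EFinM divfK.
      by rewrite setIC fineK // fP //; exact: measurableI.
    by rewrite /= gt_eqF // fine_gt0 // pos ltey_eq fP ?orbT.
have [p0 [p01 p02 p03]] := one false; have [p1 [p11 p12 p13]] := one true.
exists (fun i => if i then p1 else p0); split.
- by case=> h; [exact: p11|exact: p01].
- move=> k k0; have [e e0 eP] := p02 k k0; have [e' e'0 e'P] := p12 k k0.
  exists (Num.min e e'); first by rewrite lt_min e0.
  by case=> h; rewrite lt_min => /and3P[h0 h1 h2]; [apply: e'P|apply: eP]; rewrite h0.
- by case=> s h A; [exact: p13|exact: p03].
Qed.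

Variable q : R.
Hypothesis q_gt0 : 0 < q.
Variables a gam : bool -> R.

Lemma path_discount_measurable h lev k n x : 0 <= h ->
  measurable_fun setT (fun w => path_discount q a gam (eps ^~ w) h lev k n x).
Proof.
move=> h0; elim: k n x => [|k IH] n x /=; case: (x < lev) => //=.
apply: measurable_funM => //.
rewrite (_ : (fun w => _) = fun w => if eps (n.+1%:R * h) w
  then path_discount q a gam (eps ^~ w) h lev k n.+1 (euler a gam h true x)
  else path_discount q a gam (eps ^~ w) h lev k n.+1 (euler a gam h false x)).
  by apply: measurable_fun_ifT => //; apply: (tsm_measurable heps); rewrite mulr_ge0.
by apply/funext => w; case: (eps _ w).
Qed.

Lemma path_discount_ge0 (e : R -> bool) h lev k n x :
  0 <= path_discount q a gam e h lev k n x.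
Proof.
by elim: k n x => [|k IH] n x /=; case: ifP => // _; rewrite mulr_ge0 // expR_ge0.
Qed.

Lemma path_discount_le1 (e : R -> bool) h lev k n x : 0 <= h ->
  path_discount q a gam e h lev k n x <= 1.
Proof.
move=> h0; elim: k n x => [|k IH] n x /=; case: ifP => // _.
apply: mulr_ile1 => //; first exact: path_discount_ge0.
by rewrite expR_le1 oppr_le0 mulr_ge0 // ltW.
Qed.

(** Induction on the number of steps: condition on the state at the next grid point, and
    add the current state to the past event A. *)
Lemma integral_path_discount (p : bool -> R -> R) h lev k n i A x : 0 <= h ->
  (forall i s h A, 0 <= s -> 0 <= h -> past eps s A ->
        P (A `&` in_state eps s i `&` in_state eps (s + h) i) =
        ((p i h)%:E * P (A `&` in_state eps s i))%E) ->
  past eps (n%:R * h) A ->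
  (\int[P]_(w in A `&` in_state eps (n%:R * h) i)
     (path_discount q a gam (eps ^~ w) h lev k n x)%:E =
   (discounted a gam q (p ^~ h) h lev k i x)%:E * P (A `&` in_state eps (n%:R * h) i))%E.
Proof.
move=> h0 pP.
have mS (m : nat) j : measurable (in_state eps (m%:R * h) j).
  by apply: measurable_in_state; rewrite mulr_ge0.
have int_cst B (r : R) : measurable B -> (\int[P]_(w in B) r%:E = r%:E * P B)%E.
  by move=> mB; exact: integral_cst.
elim: k n i A x => [|k IH] n i A x pA /=.
all: have mA := past_measurable pA; have mAi := measurableI _ _ mA (mS n i).
  by case: (x < lev); exact: int_cst.
case: (x < lev); first exact: int_cst.
set A' := A `&` _ in mAi *.
have nS : n.+1%:R * h = n%:R * h + h by rewrite -natr1 mulrDl mul1r.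
have pA' : past eps (n.+1%:R * h) A'.
  have le_n : n%:R * h <= n.+1%:R * h by rewrite nS lerDl.
  apply: past_setI; first exact: past_le pA.
  by apply: past_in_state; rewrite le_n mulr_ge0.
have mstep : measurable_fun setT (fun w => (path_discount q a gam (eps ^~ w) h lev k n.+1
    (euler a gam h (eps (n.+1%:R * h) w) x))%:E).
  apply/measurable_EFinP.
  rewrite (_ : (fun w => _) = fun w => if eps (n.+1%:R * h) w
    then path_discount q a gam (eps ^~ w) h lev k n.+1 (euler a gam h true x)
    else path_discount q a gam (eps ^~ w) h lev k n.+1 (euler a gam h false x)).
    apply: measurable_fun_ifT => //; try exact: path_discount_measurable.
    by apply: (tsm_measurable heps); rewrite mulr_ge0.
  by apply/funext => w; case: (eps _ w).
under eq_integral do rewrite EFinM.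
rewrite ge0_integralZl_EFin ?expR_ge0 //; last 2 first.
- by move=> w _; rewrite lee_fin path_discount_ge0.
- exact: measurable_funTS.
have split : A' = (A' `&` in_state eps (n.+1%:R * h) i) `|` (A' `&` in_state eps (n.+1%:R * h) (~~ i)).
  rewrite -setIUr (_ : _ `|` _ = setT) ?setIT //.
  by apply/seteqP; split=> // w _; rewrite /in_state /=; case: (eps _ w) (i) => -[]; auto.
have mJ j := measurableI _ _ mAi (mS n.+1 j).
have disj : [disjoint A' `&` in_state eps (n.+1%:R * h) i & A' `&` in_state eps (n.+1%:R * h) (~~ i)].
  apply/disj_setPS => w [[_ +] [_ +]]; rewrite /in_state /= => -> /eqP.
  by case: (i).
have piece j : (\int[P]_(w in A' `&` in_state eps (n.+1%:R * h) j)
    (path_discount q a gam (eps ^~ w) h lev k n.+1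
       (euler a gam h (eps (n.+1%:R * h) w) x))%:E =
    (discounted a gam q (p ^~ h) h lev k j (euler a gam h j x))%:E *
       P (A' `&` in_state eps (n.+1%:R * h) j))%E.
  rewrite -(IH n.+1 j A' (euler a gam h j x) pA').
  by apply: eq_integral => w /set_mem [_]; rewrite /in_state /= => ->.
have stay : P (A' `&` in_state eps (n.+1%:R * h) i) = ((p i h)%:E * P A')%E.
  by rewrite nS /A' pP // mulr_ge0.
have fA : P A' \is a fin_num by exact: fin_num_measure.
have leave : P (A' `&` in_state eps (n.+1%:R * h) (~~ i)) = ((1 - p i h)%:E * P A')%E.
  have : P A' = (P (A' `&` in_state eps (n.+1%:R * h) i)
               + P (A' `&` in_state eps (n.+1%:R * h) (~~ i)))%E.
    by rewrite {1}split; exact: measureU (eqP disj).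
  have fJ : P (A' `&` in_state eps (n.+1%:R * h) (~~ i)) \is a fin_num.
    exact: fin_num_measure.
  rewrite stay -(fineK fA) -(fineK fJ) -EFinM -EFinD => -[e].
  by rewrite -EFinM; congr (_%:E); rewrite mulrBl mul1r {1}e addrC addKr.
rewrite {1}split ge0_integral_setU //; last 2 first.
- exact: measurable_funTS.
- by move=> w _; rewrite lee_fin path_discount_ge0.
rewrite !piece stay leave.
move: fA; case: (P A') => // r _.
by rewrite -!EFinM; congr (_%:E); ring.
Qed.


End MarkovChain.

(** * Pathwise convergence of the Euler scheme *)

Section Discretization.
Context {R : realType}.
Local Notation mu := (@lebesgue_measure R).

Definition mesh (m : nat) : R := m.+1%:R^-1.

Lemma mesh_gt0 m : 0 < mesh m. Proof. by rewrite invr_gt0. Qed.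

Lemma mesh_lt (r : R) : 0 < r -> \forall m \near \oo, mesh m < r.
Proof.
move=> r0; exists (Num.truncn r^-1) => // m /= mr.
rewrite /mesh -[r]invrK ltf_pV2 ?posrE ?invr_gt0 //.
by apply: lt_le_trans (truncnS_gt _) _; rewrite ler_nat ltnS.
Qed.

(** The first grid point strictly to the right of s: by right-continuity the state there is
    eventually the state at s. *)
Definition next_grid (h s : R) : R := (Num.truncn (s / h)).+1%:R * h.

Lemma next_grid_itv (h s : R) : 0 < h -> 0 <= s -> s < next_grid h s <= s + h.
Proof.
move=> h0 s0; have /truncn_itv/andP[e1 e2] : 0 <= s / h by rewrite divr_ge0 // ltW.
rewrite /next_grid -ltr_pdivrMr // e2 /= -natr1 mulrDl mul1r lerD2r.
by rewrite -ler_pdivlMr.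
Qed.

Lemma next_gridE (h s : R) k : 0 < h -> k%:R * h <= s < k.+1%:R * h ->
  next_grid h s = k.+1%:R * h.
Proof.
move=> h0 /andP[s1 s2]; rewrite /next_grid (@truncn_def _ _ k) //.
by rewrite ler_pdivlMr // ltr_pdivrMr // s1.
Qed.

Variable e : R -> bool.
Hypothesis e_right : forall t, 0 <= t -> \forall s \near t^'+, e s = e t.

Lemma next_grid_state s : 0 <= s -> \forall m \near \oo, e (next_grid (mesh m) s) = e s.
Proof.
move=> s0; have [r /= r0 rP] := e_right s0; near=> m.
have /andP[s1 s2] := next_grid_itv (mesh_gt0 m) s0.
apply: rP => //=; rewrite ltr0_norm ?subr_lt0 // opprB ltrBlDl.
apply: le_lt_trans s2 _; rewrite ltrD2l; near: m; exact: mesh_lt.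
Unshelve. all: by end_near. Qed.

Lemma measurable_next_grid_state m :
  measurable ([set s : R | 0 <= s] `&` [set s | e (next_grid (mesh m) s)]).
Proof.
have h0 := mesh_gt0 m.
rewrite (_ : _ `&` _ = \bigcup_(k in [set k | e (k.+1%:R * mesh m)])
  `[k%:R * mesh m, k.+1%:R * mesh m[%classic); last first.
  apply/seteqP; split=> [s /= [s0 es]|s [k /= ek]].
    exists (Num.truncn (s / mesh m)) => //=.
    have /truncn_itv/andP[e1 e2] : 0 <= s / mesh m by rewrite divr_ge0 // ltW.
    by rewrite in_itv /= -ler_pdivlMr // -ltr_pdivrMr // e1.
  rewrite in_itv /= => sk; split; last by rewrite (next_gridE h0 sk).
  by apply: le_trans (proj1 (andP sk)); rewrite mulr_ge0 // ltW.
by apply: bigcup_measurable => k _; exact: measurable_itv.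
Qed.

(** The state is true at s iff it is eventually true at the next grid points. *)
Lemma measurable_state : measurable_fun [set s : R | 0 <= s] e.
Proof.
apply: (measurable_fun_bool true).
rewrite (_ : _ `&` _ = \bigcup_N \bigcap_(m in [set m | (N <= m)%N])
  ([set s : R | 0 <= s] `&` [set s | e (next_grid (mesh m) s)])); last first.
  apply/seteqP; split=> [s /= [s0 es]|s [N _ sN]].
    have [N _ NP] := next_grid_state s0.
    by exists N => // m /= Nm; split=> //; rewrite /= NP.
  have [s0 _] := sN N (leqnn N); split => //=.
  have [N' _ NP] := next_grid_state s0.
  rewrite -(NP (maxn N N')) /=; last exact: leq_maxr.
  by have [] := sN (maxn N N') (leq_maxl _ _).
apply: bigcup_measurable => N _; apply: bigcap_measurable => [|m _]; last first.
  exact: measurable_next_grid_state.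
by exists N => /=.
Qed.

Variables (a gam : bool -> R).
Hypothesis gam_gt0 : forall i, 0 < gam i.
Variables (x : R) (X : R -> R).
Hypothesis X_cont : {within `[0, +oo[, continuous X}.
Hypothesis X_eq : forall t, 0 <= t ->
  X t = x + \int[mu]_(s in `[0, t]) (a (e s) - gam (e s) * X s).

Local Notation drift j y := (a j - gam j * y).

Fixpoint euler_path (h : R) (n : nat) : R :=
  if n is k.+1 then euler a gam h (e (k.+1%:R * h)) (euler_path h k) else x.

Lemma X0 : X 0 = x.
Proof. by rewrite X_eq // set_itv1 Rintegral_set1 addr0. Qed.

Lemma measurable_X (t : R) : measurable_fun (`[0, t[ : set R) X.
Proof.
apply: (@subspace_continuous_measurable_fun R `[0, t[%classic) => //.
by apply: continuous_subspaceW X_cont => s /=; rewrite !in_itv /= => /andP[->].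
Qed.

Lemma measurable_drift (c : R -> bool) (t : R) : measurable_fun (`[0, t[ : set R) c ->
  measurable_fun (`[0, t[ : set R) (fun s => drift (c s) (X s)).
Proof.
move=> mc; have mdrift j : measurable_fun (`[0, t[ : set R) (fun s => drift j (X s)).
  apply: measurable_funB => //; apply: measurable_funM => //; exact: measurable_X.
rewrite (_ : (fun s => _) = fun s => if c s then drift true (X s) else drift false (X s)).
  by apply: measurable_fun_if => //; apply: measurable_funS (mdrift _) => // s [].
by apply/funext => s; case: (c s).
Qed.

Lemma X_bounded (T : R) : 0 <= T -> exists2 B : R, 0 <= B &
  forall j s, 0 <= s <= T -> `|drift j (X s)| <= B.
Proof.
move=> T0; have cont : {within `[0, T], continuous X}.
  by apply: continuous_subspaceW X_cont => s /=; rewrite !in_itv /= => /andP[->].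
have /compact_bounded[M [_ mrt]] := continuous_compact cont (@segment_compact R 0 T).
have M1 s : 0 <= s <= T -> `|X s| <= M + 1.
  move=> sT; apply: (mrt (M + 1)); first by rewrite ltrDl.
  by exists s => //=; rewrite in_itv.
have M0 : 0 <= M + 1 by apply: le_trans (M1 0 _); rewrite ?lexx.
exists (\sum_(j : bool) (`|a j| + gam j * (M + 1))).
  by apply: sumr_ge0 => j _; rewrite addr_ge0 // mulr_ge0 // ltW.
move=> j s sT; apply: (@le_trans _ _ (`|a j| + gam j * (M + 1))).
  apply: le_trans (ler_normB _ _) _; rewrite lerD2l normrM (gtr0_norm (gam_gt0 j)).
  by rewrite ler_pM2l // M1.
rewrite (bigD1 j) //= lerDl sumr_ge0 // => k _.
by rewrite addr_ge0 // mulr_ge0 // ltW.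
Qed.

Lemma integrable_drift (c : R -> bool) (T r s : R) : 0 <= r -> s <= T ->
  measurable_fun (`[0, T[ : set R) c ->
  mu.-integrable (`[r, s[ : set R) (EFin \o (fun u => drift (c u) (X u))).
Proof.
move=> r0 sT mc; have [T0|T0] := leP 0 T; last first.
  rewrite set_itv_ge; first exact: integrable_set0.
  by rewrite bnd_simp -leNgt; lra.
have [B B0 bX] := X_bounded T0.
apply: (@integrableS _ _ _ mu `[0, T[) => //.
  by move=> u /=; rewrite !in_itv /= => /andP[ru us]; rewrite (le_trans r0 ru) (lt_le_trans us sT).
apply: measurable_bounded_integrable => //.
- have fin : (mu `[0%R, T[%classic < +oo)%E.
    by rewrite lebesgue_measure_itv /= lte_fin; case: ifP => _; rewrite ltry.
  exact: fin.
- exact: measurable_drift.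
- exists B; split; first exact: num_real.
  move=> M BM u /=; rewrite in_itv /= => /andP[u0 uT].
  by apply: le_trans (ltW BM); apply: bX; rewrite u0 ltW.
Qed.

Lemma measurable_e (T : R) : measurable_fun (`[0, T[ : set R) e.
Proof.
apply: measurable_funS measurable_state => //.
  rewrite (_ : [set s | _] = `[0, +oo[%classic); first exact: measurable_itv.
  by apply/seteqP; split=> s /=; rewrite in_itv /= andbT.
by move=> s /=; rewrite in_itv /= => /andP[].
Qed.

Lemma X_increment (r s : R) : 0 <= r -> r <= s ->
  X s - X r = \int[mu]_(u in `[r, s[) (drift (e u) (X u)).
Proof.
move=> r0 rs; have s0 := le_trans r0 rs.
have s1 : s <= s + 1 by rewrite lerDl.
have int_co t t' : 0 <= t -> t' <= s + 1 ->
    mu.-integrable (`[t, t'[ : set R) (EFin \o (fun u => drift (e u) (X u))).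
  by move=> t0 t's; apply: (@integrable_drift _ (s + 1)) => //; exact: measurable_e.
have int_cc t t' : 0 <= t -> t' <= s ->
    mu.-integrable (`[t, t'] : set R) (EFin \o (fun u => drift (e u) (X u))).
  move=> t0 t's; apply: integrableS (int_co t (s + 1) t0 (lexx _)) => //.
  move=> u /=; rewrite !in_itv /= => /andP[-> ut]; apply: le_lt_trans ut _; lra.
rewrite !X_eq // opprD addrACA subrr add0r Rintegral_itvB //; last exact: int_cc.
rewrite Rintegral_itv_obnd_cbnd; last first.
  apply: integrableS (int_cc r s r0 (lexx _)) => //.
  by move=> u /=; rewrite !in_itv /= => /andP[/ltW ->].
by rewrite Rintegral_itv_bndo_bndc //; exact: int_co.
Qed.

Lemma Rintegral_cst_itv (r s k : R) : r <= s ->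
  \int[mu]_(u in `[r, s[) k = k * (s - r).
Proof.
move=> rs; rewrite Rintegral_cst // /= lebesgue_measure_itv /= lte_fin.
case: ltP => //= sr; have -> : s = r by apply/eqP; rewrite eq_le rs sr.
by rewrite subrr.
Qed.

Lemma integrable_cst_itv (r s k : R) : mu.-integrable (`[r, s[ : set R) (EFin \o (fun=> k)).
Proof.
apply: measurable_bounded_integrable => //.
- have fin : (mu `[r, s[%classic < +oo)%E.
    by rewrite lebesgue_measure_itv /= lte_fin; case: ifP => _; rewrite ltry.
  exact: fin.
- by exists `|k|; split; [exact: num_real|move=> M kM u _; exact: ltW].
Qed.

Lemma X_lipschitz (T B r s : R) : 
  (forall j s, 0 <= s <= T -> `|drift j (X s)| <= B) ->
  0 <= r -> r <= s -> s <= T -> `|X s - X r| <= B * (s - r).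
Proof.
move=> bX r0 rs sT; rewrite X_increment //.
have mi := @integrable_drift e T r s r0 sT (@measurable_e T).
apply: le_trans (le_normr_Rintegral _ mi) _ => //.
rewrite -Rintegral_cst_itv //; apply: le_Rintegral => //.
- by have := integrable_abse mi; apply.
- exact: integrable_cst_itv.
by move=> u /=; rewrite in_itv /= => /andP[ru us]; apply: bX; rewrite (le_trans r0) //= (le_trans (ltW us)).
Qed.

Lemma measurable_next_grid (m : nat) (T : R) :
  measurable_fun (`[0, T[ : set R) (fun s => e (next_grid (mesh m) s)).
Proof.
apply: (@measurable_funS _ _ _ _ [set s : R | 0 <= s]).
- rewrite (_ : [set s | _] = `[0, +oo[%classic); first exact: measurable_itv.
  by apply/seteqP; split=> s /=; rewrite in_itv /= andbT.
- by move=> s /=; rewrite in_itv /= => /andP[].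
- by apply: (measurable_fun_bool true); exact: measurable_next_grid_state.
Qed.

(** Error made on the drift by replacing the state at s by the state at the next grid point. *)
Definition grid_defect m s :=
  `|drift (e s) (X s) - drift (e (next_grid (mesh m) s)) (X s)|.

Lemma measurable_grid_defect m (T : R) : measurable_fun (`[0, T[ : set R) (grid_defect m).
Proof.
apply: measurableT_comp => //; apply: measurable_funB; apply: measurable_drift.
  exact: measurable_e.
exact: measurable_next_grid.
Qed.

Lemma integrable_grid_defect m (T r s : R) : 0 <= r -> s <= T ->
  mu.-integrable (`[r, s[ : set R) (EFin \o grid_defect m).
Proof.
move=> r0 sT.
have i1 := integrable_drift r0 sT (@measurable_e T).
have i2 := integrable_drift r0 sT (@measurable_next_grid m T).
have i3 := @integrableB _ _ _ mu (`[r, s[ : set R) _ _ _ i1 i2.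
by have := integrable_abse (i3 _); apply.
Qed.

(** Dominated convergence: the defect at s vanishes as soon as the grid is fine enough. *)
Lemma grid_defect_integral_cvg0 (T : R) : 0 <= T ->
  (\int[mu]_(s in `[0, T[) grid_defect m s) @[m --> \oo] --> (0 : R).
Proof.
move=> T0; have [B B0 bX] := X_bounded T0.
have [] := @dominated_convergence _ _ _ mu (`[0, T[ : set R) _
  (fun m s => (grid_defect m s)%:E) (cst 0%E) (cst (2 * B)%:E) _ _ _ _ _ => //.
- by move=> m; apply/measurable_EFinP; exact: measurable_grid_defect.
- apply: aeW => s /=; rewrite in_itv /= => /andP[s0 _].
  apply: cvg_near_cst; near=> m.
  rewrite /grid_defect (_ : e (next_grid _ s) = e s) ?subrr ?normr0 //.
  by near: m; exact: next_grid_state.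
- exact: integrable_cst_itv.
- apply: aeW => s m /=; rewrite in_itv /= => /andP[s0 sT].
  rewrite lee_fin ger0_norm ?normr_ge0 //.
  apply: le_trans (ler_normB _ _) _.
  by rewrite mulr_natl mulr2n; apply: lerD; apply: bX; rewrite s0 ltW.
move=> _ _; rewrite integral0 => H; have := fine_cvg H; apply.
Unshelve. all: by end_near. Qed.

Lemma X_step (T B G : R) m k : 0 <= T -> 0 <= B -> (forall j, gam j <= G) ->
  (forall j s, 0 <= s <= T -> `|drift j (X s)| <= B) ->
  let h := mesh m in let j := e (k.+1%:R * h) in k.+1%:R * h <= T ->
  `|X (k.+1%:R * h) - X (k%:R * h) - h * drift j (X (k%:R * h))| <=
  \int[mu]_(s in `[k%:R * h, k.+1%:R * h[) grid_defect m s + G * B * h * h.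
Proof.
move=> T0 B0 gG bX h j kT; have h0 : 0 < h by exact: mesh_gt0.
set r := k%:R * h; set s := k.+1%:R * h in j kT *.
have r0 : 0 <= r by rewrite mulr_ge0 // ltW.
have sr : s = r + h by rewrite /s -natr1 mulrDl mul1r.
have srh : s - r = h by rewrite sr addrC addKr.
have rs : r <= s by rewrite sr lerDl ltW.
have G0 : 0 <= G by apply: le_trans (gG true); exact: ltW.
have i1 := @integrable_drift e T r s r0 kT (@measurable_e T).
have i2 := integrable_grid_defect m r0 kT.
pose y := X r.
rewrite X_increment // -/y.
have -> : h * drift j y = \int[mu]_(u in `[r, s[) drift j y.
  by rewrite Rintegral_cst_itv // srh mulrC.
rewrite -RintegralB //; last exact: integrable_cst_itv.
have i3 : mu.-integrable (`[r, s[ : set R) (EFin \o (fun u => drift (e u) (X u) - drift j y)).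
  by have := integrableB _ i1 (integrable_cst_itv r s (drift j y)); apply.
apply: le_trans (le_normr_Rintegral _ i3) _ => //.
have -> : G * B * h * h = \int[mu]_(u in `[r, s[) (G * B * h).
  by rewrite Rintegral_cst_itv // srh.
rewrite -RintegralD //; last exact: integrable_cst_itv.
apply: le_Rintegral => //.
- by have := integrable_abse i3; apply.
- by have := integrableD _ i2 (integrable_cst_itv r s (G * B * h)); apply.
move=> u /=; rewrite in_itv /= => /andP[ru us].
have u0 := le_trans r0 ru; have uT := le_trans (ltW us) kT.
rewrite /grid_defect (_ : next_grid _ u = s); last first.
  by apply: next_gridE => //; rewrite ru us.
have -> : drift (e u) (X u) - drift j y =
  (drift (e u) (X u) - drift j (X u)) - gam j * (X u - y) by ring.
apply: le_trans (ler_normB _ _) _; rewrite lerD2l normrM (gtr0_norm (gam_gt0 j)).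
rewrite -mulrA; apply: ler_pM => //; first exact: ltW.
apply: le_trans (X_lipschitz bX r0 ru uT) _; apply: ler_wpM2l => //.
by rewrite sr in us; lra.
Qed.

(** The one-step errors add up, since the Euler step is non-expanding when mesh m * gam j <= 1. *)
Lemma euler_path_close (T B G : R) m : 0 <= T -> 0 <= B -> (forall j, gam j <= G) ->
  (forall j s, 0 <= s <= T -> `|drift j (X s)| <= B) -> mesh m * G <= 1 ->
  forall k, k%:R * mesh m <= T ->
  `|X (k%:R * mesh m) - euler_path (mesh m) k| <=
  \int[mu]_(s in `[0, k%:R * mesh m[) grid_defect m s + G * B * mesh m * (k%:R * mesh m).
Proof.
move=> T0 B0 gG bX hG; set h := mesh m in hG *.
have h0 : 0 < h by exact: mesh_gt0.
elim=> [|k IH] kT.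
  rewrite !mul0r set_itv_ge ?bnd_simp ?ltxx // Rintegral_set0 X0 /= subrr normr0.
  by rewrite mulr0 addr0.
have kS : k.+1%:R * h = k%:R * h + h by rewrite -natr1 mulrDl mul1r.
have k0 : 0 <= k%:R * h by rewrite mulr_ge0 // ltW.
have kT' : k%:R * h <= T by rewrite kS in kT; lra.
have step := @X_step T B G m k T0 B0 gG bX kT.
set s := k.+1%:R * h in kS kT step *; set r := k%:R * h in kS IH k0 kT' step *.
have -> : `[0, s[%classic = `[0, r[%classic `|` `[r, s[%classic :> set R.
  by apply: itv_bndbnd_setU; rewrite bnd_simp // kS lerDl ltW.
have disj : [disjoint (`[0, r[%classic : set R) & `[r, s[%classic].
  apply/disj_setPS => u [/=]; rewrite !in_itv /= => /andP[_ ur] /andP[ru _].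
  by move: ru; rewrite leNgt ur.
rewrite Rintegral_setU //; last first.
  rewrite -itv_bndbnd_setU ?bnd_simp // ?kS ?lerDl ?(ltW h0) //.
  by apply: (@integrable_grid_defect m T) => //; rewrite -kS.
set j := e s in step; set w := euler_path h k in IH.
have -> : euler_path h k.+1 = w + h * drift j w by [].
have -> : X s - (w + h * drift j w) =
  (X s - X r - h * drift j (X r)) + (1 - h * gam j) * (X r - w) by ring.
apply: le_trans (ler_normD _ _) _; rewrite normrM.
have gj : 0 <= 1 - h * gam j.
  by rewrite subr_ge0; apply: le_trans hG; rewrite ler_pM2l.
rewrite (ger0_norm gj).
have gj1 : 1 - h * gam j <= 1 by rewrite lerBlDr lerDl mulr_ge0 // ltW.
have D1 : (1 - h * gam j) * `|X r - w| <= `|X r - w| by rewrite ler_piMl.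
have IH' := IH kT'; move: step D1 IH'; rewrite -/h [G * B * h * s]mulrC kS.
set I1 := Rintegral _ _ _; set I2 := Rintegral _ _ _.
move=> s1 s2 s3; lra.
Qed.

Lemma euler_path_cvg (T eta : R) : 0 <= T -> 0 < eta ->
  \forall m \near \oo, forall k, k%:R * mesh m <= T ->
    `|X (k%:R * mesh m) - euler_path (mesh m) k| <= eta.
Proof.
move=> T0 eta0; have [B B0 bX] := X_bounded T0.
pose G := gam false + gam true.
have gG j : gam j <= G by rewrite /G; case: j; rewrite ?lerDl ?lerDr ltW.
have G0 : 0 < G by rewrite addr_gt0.
have M0 : 0 < G * B * T + 1 by rewrite ltr_wpDl // !mulr_ge0 // ltW.
have e2 : 0 < eta / 2 by rewrite divr_gt0.
have /cvgrPdist_lt /(_ _ e2) small := grid_defect_integral_cvg0 T0.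
near=> m => k kT.
have h0 := mesh_gt0 m.
have hG : mesh m * G <= 1.
  rewrite -ler_pdivlMr // mul1r; apply: ltW; near: m; apply: mesh_lt.
  by rewrite invr_gt0.
apply: le_trans (euler_path_close T0 B0 gG bX hG kT) _.
have hM : mesh m * (G * B * T + 1) <= eta / 2.
  rewrite -ler_pdivlMr //; apply: ltW; near: m; apply: mesh_lt; exact: divr_gt0.
have k0 : 0 <= k%:R * mesh m by rewrite mulr_ge0 // ltW.
have E1 : G * B * mesh m * (k%:R * mesh m) <= eta / 2.
  apply: le_trans hM; have : G * B * mesh m * (k%:R * mesh m) <= G * B * mesh m * T.
    by rewrite ler_wpM2l // !mulr_ge0 // ltW.
  by have := ltW h0; lra.
have E2 : \int[mu]_(s in `[0, k%:R * mesh m[) grid_defect m s <=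
    \int[mu]_(s in `[0, T[) grid_defect m s.
  have -> : `[0, T[%classic = `[0, k%:R * mesh m[%classic `|` `[k%:R * mesh m, T[%classic :> set R.
    by apply: itv_bndbnd_setU; rewrite bnd_simp.
  rewrite Rintegral_setU //.
  - by rewrite lerDl; apply: Rintegral_ge0 => s _; exact: normr_ge0.
  - rewrite -itv_bndbnd_setU ?bnd_simp //.
    exact: (@integrable_grid_defect m T).
  - apply/disj_setPS => u [/=]; rewrite !in_itv /= => /andP[_ ur] /andP[ru _].
    by move: ru; rewrite leNgt ur.
have E3 : \int[mu]_(s in `[0, T[) grid_defect m s < eta / 2.
  apply: le_lt_trans (ler_norm _) _; rewrite -normrN -sub0r.
  by near: m; exact: small.
rewrite [eta]splitr; apply: lerD => //; exact: le_trans E2 (ltW E3).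
Unshelve. all: by end_near. Qed.

Variable q : R.
Hypothesis q_gt0 : 0 < q.

Lemma path_discount_ge (h lev : R) k n l : 0 < h -> (l <= k)%N ->
  euler_path h (n + l) < lev ->
  expR (- (q * h)) ^+ l <= path_discount q a gam e h lev k n (euler_path h n).
Proof.
move=> h0; elim: l k n => [|l IH] k n lk; rewrite ?addn0.
  by move=> xl; rewrite expr0; case: k lk => [|k] _ /=; rewrite xl.
case: k lk => // k lk xl; rewrite /= ; case: ifP => _.
  by rewrite exprn_ile1 ?expR_ge0 // expR_le1 oppr_le0 mulr_ge0 // ltW.
rewrite exprS ler_wpM2l ?expR_ge0 //.
by apply: (IH k n.+1) => //; rewrite addSnnS.
Qed.

Lemma path_discount_le (h lev : R) k n l : 0 < h ->
  (forall l', (l' < l)%N -> lev <= euler_path h (n + l')) ->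
  path_discount q a gam e h lev k n (euler_path h n) <= expR (- (q * h)) ^+ l.
Proof.
move=> h0; elim: l k n => [|l IH] k n xl.
  by rewrite expr0 path_discount_le1 // ltW.
have := xl 0%N isT; rewrite addn0 => xn.
case: k => [|k] /=; rewrite ltNge xn /=; first by rewrite exprn_ge0 ?expR_ge0.
rewrite exprS ler_wpM2l ?expR_ge0 //.
by apply: (IH k n.+1) => l' l'l; rewrite addSnnS; exact: xl.
Qed.

(** m.+1 * m.+1 steps of mesh m cover the time interval [0, m + 1]. *)
Definition sampled_discount (lev : R) m :=
  path_discount q a gam e (mesh m) lev (m.+1 * m.+1) 0 x.

Lemma mesh_mul m : m.+1%:R * mesh m = 1 :> R.
Proof. by rewrite /mesh divff. Qed.

Lemma exp_mesh m l : expR (- (q * mesh m)) ^+ l = expR (- (q * (l%:R * mesh m))).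
Proof. by rewrite -expRM_natl; congr expR; ring. Qed.

(** If X is below the level at time s, then on a fine grid so is the Euler path at the first
    grid point after s. *)
Lemma sampled_discount_ge (lev s eta : R) : 0 <= s -> X s < lev -> 0 < eta ->
  \forall m \near \oo, expR (- (q * s)) - eta <= sampled_discount lev m.
Proof.
move=> s0 Xs eta0; pose g := lev - X s.
have g0 : 0 < g by rewrite subr_gt0.
have s1 : 0 <= s + 1 by rewrite addr_ge0.
have [B B0 bX] := X_bounded s1.
have g2 : 0 < g / 2 by rewrite divr_gt0.
have B1 : 0 < B + 1 by rewrite ltr_wpDl.
have close := @euler_path_cvg (s + 1) (g / 2 / 2) s1 (divr_gt0 g2 (ltr0Sn R 1)).
near=> m.
have h0 := mesh_gt0 m.
have /andP[n1 n2] := next_grid_itv h0 s0.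
pose k := (Num.truncn (s / mesh m)).+1.
have kE : next_grid (mesh m) s = k%:R * mesh m by [].
rewrite kE in n1 n2.
have h1 : mesh m < 1 by near: m; exact: mesh_lt.
have kT : k%:R * mesh m <= s + 1 by apply: le_trans n2 _; rewrite lerD2l ltW.
have c1 : `|X (k%:R * mesh m) - euler_path (mesh m) k| <= g / 2 / 2.
  by move: k kT {kE n1 n2}; near: m; exact: close.
have c2 : `|X (k%:R * mesh m) - X s| <= B * (k%:R * mesh m - s).
  exact: X_lipschitz bX s0 (ltW n1) kT.
have hB : mesh m * (B + 1) < g / 2.
  by rewrite -ltr_pdivlMr //; near: m; apply: mesh_lt; exact: divr_gt0.
have c3 : B * (k%:R * mesh m - s) <= B * mesh m by rewrite ler_wpM2l // lerBlDl.
have low : euler_path (mesh m) k < lev.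
  move: c1 c2 c3 hB g0; rewrite /g !ler_norml.
  move: (euler_path _ k) (X (k%:R * mesh m)) (B * (k%:R * mesh m - s)) => u v w.
  by move: (X s) (mesh m) h0 => y h {}h0; lra.
have kK : (k <= m.+1 * m.+1)%N.
  rewrite -(ler_nat R) natrM -(ler_pM2r h0) -mulrA mesh_mul mulr1.
  apply: le_trans kT _; rewrite -(ler_pM2r h0) mesh_mul mulrC -ler_pdivlMr ?ltr_wpDl //.
  by rewrite mul1r; apply: ltW; near: m; apply: mesh_lt; rewrite invr_gt0 ltr_wpDl.
have := @path_discount_ge (mesh m) lev (m.+1 * m.+1) 0 k h0 kK low.
rewrite /sampled_discount; apply: le_trans.
rewrite exp_mesh; apply: (@le_trans _ _ (expR (- (q * (s + mesh m))))); last first.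
  by rewrite ler_expR lerN2 ler_pM2l.
have qh : q * mesh m < eta.
  by rewrite mulrC -ltr_pdivlMr //; near: m; apply: mesh_lt; exact: divr_gt0.
rewrite mulrDr opprD expRD.
have := expR_ge1Dx (- (q * mesh m)).
have : expR (- (q * s)) <= 1 by rewrite expR_le1 oppr_le0 mulr_ge0 // ltW.
have := expR_ge0 (- (q * s)).
have : 0 < q * mesh m by rewrite mulr_gt0.
move: (expR (- (q * s))) (expR _) (q * mesh m) qh => u v w *; nra.
Unshelve. all: by end_near. Qed.

(** While X is above the level, the Euler path on a fine grid stays above any strictly lower
    level. *)
Lemma sampled_discount_le (lev del t eta : R) : 0 <= t -> 0 < del -> 0 < eta ->
  (forall s, 0 <= s < t -> lev <= X s) ->
  \forall m \near \oo, sampled_discount (lev - del) m <= expR (- (q * t)) + eta.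
Proof.
move=> t0 del0 eta0 above.
have close := @euler_path_cvg t del t0 del0.
near=> m; have h0 := mesh_gt0 m.
pose l := Num.truncn (t / mesh m).
have /truncn_itv/andP[l1 l2] : 0 <= t / mesh m by rewrite divr_ge0 // ltW.
rewrite ler_pdivlMr // in l1; rewrite ltr_pdivrMr // -natr1 mulrDl mul1r in l2.
have := @path_discount_le (mesh m) (lev - del) (m.+1 * m.+1) 0 l h0.
rewrite /sampled_discount => /(_ _)/le_trans; apply.
  move=> l' l'l; rewrite add0n.
  have l't : l'%:R * mesh m < t by apply: lt_le_trans l1; rewrite ltr_pM2r // ltr_nat.
  have c1 : `|X (l'%:R * mesh m) - euler_path (mesh m) l'| <= del.
    by move: l' l't {l'l} => l' /ltW; move: l'; near: m; exact: close.
  have c2 : lev <= X (l'%:R * mesh m) by apply: above; rewrite l't mulr_ge0 // ltW.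
  by move: c1; rewrite ler_norml; lra.
have qh : q * mesh m < eta.
  by rewrite mulrC -ltr_pdivlMr //; near: m; apply: mesh_lt; exact: divr_gt0.
rewrite exp_mesh.
have E1 : expR (- (q * (l%:R * mesh m))) * expR (- (q * mesh m)) <= expR (- (q * t)).
  rewrite -expRD ler_expR -opprD lerN2 -mulrDr ler_pM2l //; exact: ltW.
have := expR_ge1Dx (- (q * mesh m)).
have : expR (- (q * (l%:R * mesh m))) <= 1.
  by rewrite expR_le1 oppr_le0 !mulr_ge0 // ltW.
have := expR_ge0 (- (q * (l%:R * mesh m))).
move: E1; set u := expR (- (q * (_ * _))); set v := expR (- (q * mesh m)).
have : 0 < q * mesh m by rewrite mulr_gt0.
move: u v (q * mesh m) qh (expR _) => u v w wh E *; nra.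
Unshelve. all: by end_near. Qed.

End Discretization.

(** * The candidate Laplace transforms *)

Section HypergeometricSolution.
Context {R : realType}.
Variables (lam a gam : bool -> R) (q : R).
Hypothesis lam_gt0 : forall i, 0 < lam i.
Hypothesis gam_gt0 : forall i, 0 < gam i.
Hypothesis rho_lt : a true / gam true < a false / gam false.
Hypothesis q_gt0 : 0 < q.

Definition laplace_solution (i : bool) (x : R) : R :=
  if i then hypergeom (b0_par gam lam q) (b1_par gam lam q)
              (beta_par gam lam false q) (z_par a gam x)
  else lam false / (lam false + q) *
       hypergeom (b0_par gam lam q) (b1_par gam lam q)
         (beta_par gam lam false q + 1) (z_par a gam x).

Let c := beta_par gam lam false q.
Let bt := beta_par gam lam true q.
Let mu := beta_par gam lam false 0 * beta_par gam lam true 0 / c.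

Let beta_gt0 i r : 0 <= r -> 0 < beta_par gam lam i r.
Proof. by move=> r0; rewrite divr_gt0 // ltr_wpDr. Qed.

Let c_gt0 : 0 < c. Proof. exact/beta_gt0/ltW. Qed.
Let bt_ge0 : 0 <= bt. Proof. exact/ltW/beta_gt0/ltW. Qed.
Let mu_ge0 : 0 <= mu.
Proof. by rewrite divr_ge0 ?(ltW c_gt0) // mulr_ge0 // ltW // beta_gt0. Qed.

Let bD : b0_par gam lam q + b1_par gam lam q = c + bt.
Proof. by rewrite /b0_par /b1_par -/c -/bt; field. Qed.

Let bM : b0_par gam lam q * b1_par gam lam q = c * bt - mu * c.
Proof.
rewrite /mu divfK ?gt_eqF // /b0_par /b1_par -/c -/bt.
set s := Num.sqrt _.
have s2 : s ^+ 2 = (c - bt) ^+ 2 + 4 * beta_par gam lam false 0 * beta_par gam lam true 0.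
  rewrite sqr_sqrtr // /b_discr addr_ge0 ?sqr_ge0 //.
  have p0 := beta_gt0 false (lexx 0); have p1 := beta_gt0 true (lexx 0).
  exact: mulr_ge0 (mulr_ge0 (ler0n _ 4) (ltW p0)) (ltW p1).
transitivity (4^-1 * ((c + bt) ^+ 2 - s ^+ 2)); first by field.
by rewrite s2; field.
Qed.

Lemma z_par_lt1 x : a true / gam true < x -> z_par a gam x < 1.
Proof.
by move=> xr; rewrite /z_par ltr_pdivrMr ?subr_gt0 // mul1r ltrD2l ltrN2.
Qed.

Lemma laplace_solution_level : laplace_solution true (a false / gam false) = 1.
Proof.
rewrite /laplace_solution /z_par subrr mul0r.
exact: (hypergeom0 c_gt0 bt_ge0 mu_ge0 bD bM).
Qed.

(** The hypergeometric system in the coordinate x: the factor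
    (a false - gam false * x) * dz/dx is - gam false * z, and
    (a true - gam true * x) * dz/dx is gam true * (1 - z). *)
Lemma laplace_solution_generator i x : a true / gam true < x ->
  exists2 d : R, is_derive x 1 (laplace_solution i) d &
  (a i - gam i * x) * d =
    (q + lam i) * laplace_solution i x - lam i * laplace_solution (~~ i) x.
Proof.
move=> xr; have z1 := z_par_lt1 xr.
have [dF [dG [DF DG eF eG]]] := hypergeom_solves_system c_gt0 bt_ge0 mu_ge0 bD bM z1.
set D := a false / gam false - a true / gam true.
have D0 : D != 0 by rewrite gt_eqF // subr_gt0.
have Dz : is_derive x 1 (z_par a gam) (- D^-1).
  rewrite (_ : z_par a gam = fun y => (- D^-1) * y + (a false / gam false) / D).
    apply: is_derive_eq; by rewrite /GRing.scale /= mulr1 addr0.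
  by apply/funext => y; rewrite /z_par -/D mulrBl mulNr addrC [y / D]mulrC.
have g0 j : gam j != 0 by rewrite gt_eqF.
have lq : lam false + q != 0 by rewrite gt_eqF // addr_gt0.
have zE : a false - gam false * x = gam false * D * z_par a gam x.
  by rewrite /z_par -/D; field; rewrite D0 g0.
have z1E : a true - gam true * x = - (gam true * D * (1 - z_par a gam x)).
  rewrite -mulrA mulrBr mulr1 [D * _]mulrC divfK // /D.
  have aE j : a j = gam j * (a j / gam j) by rewrite mulrC divfK.
  by rewrite {1}aE; ring.
have cE : gam false * c = lam false + q by rewrite /c /beta_par; field.
have DFz := @is_derive1_comp _ _ _ x _ _ DF Dz.
have DGz := @is_derive1_comp _ _ _ x _ _ DG Dz.
case: i; rewrite /laplace_solution /=.
- exists (dG * - D^-1); first exact: DGz.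
  rewrite z1E; set z := z_par a gam x in eF eG *.
  have -> : - (gam true * D * (1 - z)) * (dG * - D^-1) = gam true * ((1 - z) * dG).
    by field.
  rewrite eG /bt /mu /c /beta_par; field.
  by rewrite !g0 lq.
- exists (lam false / (lam false + q) * (dF * - D^-1)).
    have H := is_deriveZ (lam false / (lam false + q)) DFz.
    exact: (is_derive_eq H).
  rewrite zE; set z := z_par a gam x in eF eG *.
  have -> : gam false * D * z * (lam false / (lam false + q) * (dF * - D^-1)) =
     - (lam false / (lam false + q)) * gam false * (z * dF).
    by field; rewrite lq D0.
  rewrite eF.
  have -> : - (lam false / (lam false + q)) * gam false * (c * (hypergeom (b0_par gam lam q) (b1_par gam lam q) c z - hypergeom (b0_par gam lam q) (b1_par gam lam q) (c + 1) z)) = - (lam false / (lam false + q)) * (gam false * c) * (hypergeom (b0_par gam lam q) (b1_par gam lam q) c z - hypergeom (b0_par gam lam q) (b1_par gam lam q) (c + 1) z) by ring.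
  by rewrite cE -/c; field.
Qed.

End HypergeometricSolution.

(** * Identification of the expectation *)

Section Liminf.
Context {R : realType}.
Local Open Scope ereal_scope.

Lemma limn_einf_le (u : (\bar R)^nat) c : (\forall n \near \oo, u n <= c) -> limn_einf u <= c.
Proof.
move=> uc; rewrite limn_einf_lim; apply: lime_le; first exact: is_cvg_einfs.
near=> n; apply: (@le_trans _ _ (u n)); last by near: n.
by apply: ereal_inf_lbound; exists n => /=.
Unshelve. all: by end_near. Qed.

Lemma limn_einf_ge (u : (\bar R)^nat) c : (\forall n \near \oo, c <= u n) -> c <= limn_einf u.
Proof.
move=> [N _ NP]; rewrite limn_einf_lim; apply: lime_ge; first exact: is_cvg_einfs.
near=> n; apply: le_ereal_inf_tmp => _ /= [k nk <-]; apply: NP => /=.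
by apply: leq_trans nk; near: n; exact: nbhs_infty_ge.
Unshelve. all: by end_near. Qed.

(** The integral of a nonnegative function is a supremum over simple functions below it, so
    that it is monotone whether or not the functions are measurable. *)
Lemma ge0_le_integral_nonmeasurable d (T : measurableType d)
    (mu : {measure set T -> \bar R}) (D : set T) (f g : T -> \bar R) :
  (forall x, D x -> 0 <= f x) -> (forall x, D x -> f x <= g x) ->
  \int[mu]_(x in D) f x <= \int[mu]_(x in D) g x.
Proof.
move=> f0 fg; have g0 x : D x -> 0 <= g x.
  by move=> Dx; exact: le_trans (f0 x Dx) (fg x Dx).
rewrite !ge0_integralE //; apply: ge_ereal_sup => _ [h /= hf <-].
apply: ereal_sup_ubound; exists h => //= x; apply: le_trans (hf x) _.
by apply: lee_restrict.
Qed.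

End Liminf.

Section FallingDiscount.
Context {R : realType}.
Variable e : R -> bool.
Hypothesis e_right : forall t, 0 <= t -> \forall s \near t^'+, e s = e t.
Variables (a gam : bool -> R).
Hypothesis gam_gt0 : forall i, 0 < gam i.
Variables (x : R) (X : R -> R).
Hypothesis X_cont : {within `[0, +oo[, continuous X}.
Hypothesis X_eq : forall t, 0 <= t ->
  X t = x + \int[lebesgue_measure]_(s in `[0, t]) (a (e s) - gam (e s) * X s).
Variable q : R.
Hypothesis q_gt0 : 0 < q.
Variable lev : R.

Let T : \bar R := ereal_inf [set t%:E | t in [set t : R | 0 <= t /\ X t < lev]].

(** A strictly lower level is needed for the upper bound: at the level itself the Euler path
    may cross although X only touches the level. *)
Lemma falling_discount : exists D : R,
  [/\ expeR (- (q%:E * T))%E = D%:E, 0 <= D <= 1,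
      forall eta, 0 < eta ->
        \forall m \near \oo, D - eta <= sampled_discount e a gam x q lev m &
      forall del eta, 0 < del -> 0 < eta ->
        \forall m \near \oo, sampled_discount e a gam x q (lev - del) m <= D + eta].
Proof.
have T0 : (0 <= T)%E by apply: le_ereal_inf_tmp => _ [t /= [t0 _] <-]; rewrite lee_fin.
have above s : (s%:E < T)%E -> 0 <= s -> lev <= X s.
  move=> sT s0; rewrite leNgt; apply/negP => Xs; move: sT; rewrite ltNge => /negP; apply.
  by apply: ereal_inf_lbound; exists s.
have pos eta m : 0 < eta -> 0 - eta <= sampled_discount e a gam x q lev m.
  by move=> eta0; apply: le_trans (path_discount_ge0 _ _ _ _ _ _ _ _ _); rewrite sub0r oppr_le0 ltW.
case E : T => [tau| |]; last by rewrite E in T0.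
- exists (expR (- (q * tau))); rewrite E in T0; rewrite lee_fin in T0; split.
  + by rewrite -EFinM.
  + by rewrite expR_ge0 expR_le1 oppr_le0 mulr_ge0 // ltW.
  + move=> eta eta0; have e2 : 0 < eta / 2 by rewrite divr_gt0.
    have e3 : 0 < eta / 2 / q by rewrite divr_gt0.
    have [|_ [t [t0 Xt] <-]] := @lb_ereal_inf_adherent _ [set t%:E | t in [set t : R | 0 <= t /\ X t < lev]] _ e3.
      by rewrite -/T E.
    rewrite -/T E -EFinD lte_fin => tt.
    have H := @sampled_discount_ge _ e e_right a gam gam_gt0 x X X_cont X_eq q q_gt0 lev t _ t0 Xt e2.
    apply: filterS H => m; apply: le_trans.
    have qt : q * t <= q * tau + eta / 2.
      by have := ltW tt; rewrite -(ler_pM2l q_gt0) mulrDr [q * (_ / q)]mulrC divfK ?gt_eqF.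
    have E1 : expR (- (q * tau)) * expR (- (eta / 2)) <= expR (- (q * t)).
      by rewrite -expRD ler_expR -opprD lerN2.
    have := expR_ge1Dx (- (eta / 2)).
    have : expR (- (q * tau)) <= 1 by rewrite expR_le1 oppr_le0 mulr_ge0 // ltW.
    have := expR_ge0 (- (q * tau)).
    move: E1; move: (expR (- (q * t))) (expR (- (q * tau))) (expR _) => w u v E1 *; nra.
  + move=> del eta del0 eta0.
    apply: (sampled_discount_le e_right gam_gt0 X_cont X_eq q_gt0 T0 del0 eta0).
    by move=> s /andP[s0 st]; apply: above => //; rewrite E lte_fin.
- exists 0; split.
  + by rewrite mulry gtr0_sg // mul1e.
  + by rewrite lexx ler01.
  + by move=> eta eta0; near=> m; exact: pos.
  + move=> del eta del0 eta0; have e2 : 0 < eta / 2 by rewrite divr_gt0.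
    pose t := (eta / 2)^-1 / q.
    have t0 : 0 <= t by rewrite divr_ge0 // ?invr_ge0 ltW.
    have := sampled_discount_le e_right gam_gt0 X_cont X_eq q_gt0 t0 del0 e2.
    move=> /(_ lev); have ab s : 0 <= s < t -> lev <= X s.
      by move=> /andP[s0 _]; apply: above => //; rewrite E ltry.
    move=> /(_ ab); apply: filterS => m; move/le_trans; apply.
    rewrite add0r [leRHS]splitr lerD2r expRN -[leRHS]invrK lef_pV2 ?posrE ?expR_gt0 ?invr_gt0 //.
    rewrite /t [q * _]mulrC divfK ?gt_eqF //; apply: le_trans (expR_ge1Dx _).
    by rewrite lerDr ler01.
Unshelve. all: by end_near. Qed.

End FallingDiscount.

Section LaplaceTransform.
Context {R : realType} {d : measure_display} {Om : measurableType d}.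
Variable P : probability Om R.
Variables (lam a gam : bool -> R).
Hypothesis lam_gt0 : forall i, 0 < lam i.
Hypothesis gam_gt0 : forall i, 0 < gam i.
Hypothesis rho_lt : a true / gam true < a false / gam false.
Variable eps : R -> Om -> bool.
Hypothesis heps : two_state_markov P lam eps.
Variables (q x : R).
Hypothesis q_gt0 : 0 < q.
Hypothesis hx : a false / gam false < x.
Variable X : R -> Om -> R.
Hypothesis hX : ou_bounded_variation a gam eps x X.

Local Notation level := (a false / gam false).
Local Notation discount w := (expeR (- (q%:E * falling_time X level w))%E).
Local Notation Y del := (fun m w => sampled_discount (eps ^~ w) a gam x q (level - del) m).

Let pathwise w : exists D : R,
  [/\ discount w = D%:E, 0 <= D <= 1,
      forall eta, 0 < eta -> \forall m \near \oo, D - eta <= Y 0 m w &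
      forall del eta, 0 < del -> 0 < eta -> \forall m \near \oo, Y del m w <= D + eta].
Proof.
have [D [D1 D2 D3 D4]] := @falling_discount R (eps ^~ w)
  (fun t t0 => tsm_right_cont heps w t0) a gam gam_gt0 x (X ^~ w) (@ou_continuous _ _ _ _ _ _ _ hX w)
  (fun t t0 => ou_equation hX w t0) q q_gt0 level.
by exists D; split=> // eta eta0; rewrite subr0; exact: D3.
Qed.

Let Ym del m : measurable_fun setT (Y del m).
Proof. by apply: (path_discount_measurable heps); rewrite ltW // mesh_gt0. Qed.

Let Y_ge0 del m w : 0 <= Y del m w. Proof. exact: path_discount_ge0. Qed.
Let Y_le1 del m w : Y del m w <= 1.
Proof. by apply: path_discount_le1 => //; rewrite ltW // mesh_gt0. Qed.

Variable i : bool.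
Let B := in_state eps 0 i.
Hypothesis B_gt0 : (0 < P B)%E.
Let v := laplace_solution lam a gam q i x.
Let pi := fine (P B).

Let mB : measurable B. Proof. exact: (measurable_in_state heps). Qed.
Let piE : P B = pi%:E. Proof. by rewrite fineK //; exact: fin_num_measure. Qed.
Let PB_lty : (P B < +oo)%E. Proof. by rewrite piE ltry. Qed.
Let int1 : (\int[P]_(w in B) 1%E = pi%:E)%E.
Proof. by rewrite -piE -[RHS]mul1e; exact: integral_cst. Qed.
Let pi_gt0 : 0 < pi. Proof. by rewrite -lte_fin -piE. Qed.

(** The recursion is run for m.+1 time units, after which the discount is negligible. *)
Let expectation_sampled eta : 0 < eta -> exists2 e : R, 0 < e &
  forall del, 0 <= del < e -> \forall m \near \oo, exists2 r : R, `|r - v| <= eta &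
    (\int[P]_(w in B) (Y del m w)%:E = (r * pi)%:E)%E.
Proof.
move=> eta0; have e2 : 0 < eta / 2 by rewrite divr_gt0.
have [C CP] := @discounted_estimate R lam a gam q lam_gt0 gam_gt0 rho_lt q_gt0
  (laplace_solution lam a gam q)
  (laplace_solution_generator lam_gt0 gam_gt0 rho_lt q_gt0)
  (laplace_solution_level a lam_gt0 gam_gt0 q_gt0) x.
have [e e0 eP] := CP _ e2.
have [p [p01 p02 pP]] := transition_kernel lam_gt0 heps.
have [e' e'0 e'P] := p02 e e0.
exists e => // del del_e; near=> m.
have h0 := mesh_gt0 m : 0 < mesh m :> R.
exists (discounted a gam q (p ^~ (mesh m)) (mesh m) (level - del) (m.+1 * m.+1) i x).
  apply: le_trans (eP (mesh m) del (p ^~ (mesh m)) _ _ _ _ i x _ _) _.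
  - by rewrite h0; near: m; exact: mesh_lt.
  - by [].
  - move=> j; split; first exact/p01/ltW.
    by apply: e'P; rewrite h0; near: m; exact: mesh_lt.
  - by rewrite lexx andbT lerBlDr; apply: le_trans (ltW hx) _; rewrite lerDl; case/andP: del_e.
  - exact: ltW.
  rewrite [leRHS]splitr lerD2r exp_mesh natrM -mulrA mesh_mul mulr1.
  have qm : 0 < q * m.+1%:R by rewrite mulr_gt0.
  have : expR (- (q * m.+1%:R)) <= (q * m.+1%:R)^-1.
    rewrite expRN lef_pV2 ?posrE ?expR_gt0 //; apply: le_trans (expR_ge1Dx _).
    by rewrite lerDr ler01.
  move=> E1; apply: (@le_trans _ _ (`|C| * (q * m.+1%:R)^-1)).
    apply: (le_trans (ler_wpM2r (expR_ge0 _) (ler_norm C))).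
    by rewrite ler_wpM2l.
  have small : mesh m * (`|C| + 1) <= eta / 2 * q.
    rewrite -ler_pdivlMr ?ltr_wpDl //; apply: ltW; near: m; apply: mesh_lt.
    by rewrite divr_gt0 ?ltr_wpDl // mulr_gt0.
  rewrite invfM mulrA [_ * q^-1]mulrC -mulrA ler_pdivrMl //.
  rewrite -/(mesh m) [leRHS]mulrC; apply: le_trans small.
  by rewrite mulrC ler_pM2l // lerDl ler01.
have past0 : past eps (0%:R * mesh m) setT by exact: (@measurableT _ (g_sigma_algebraType _)).
have := @integral_path_discount _ _ _ P lam eps heps q a gam p (mesh m) (level - del)
  (m.+1 * m.+1) 0 i setT x (ltW h0) pP past0.
by rewrite setTI mul0r piE -EFinM.
Unshelve. all: by end_near. Qed.

(** Upper bound: Fatou's lemma for the discounts sampled at the level. Lower bound: Fatou's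
    lemma for 1 minus the discounts sampled at a slightly lower level. *)
Lemma expectation_discount : (\int[P]_(w in B) discount w = (v * pi)%:E)%E.
Proof.
have d0 w : (0 <= discount w)%E by exact: expeR_ge0.
apply/eqP; rewrite eq_le; apply/andP; split.
- apply/lee_addgt0Pr => eta eta0.
  have eta'0 : 0 < eta / pi by rewrite divr_gt0.
  have [e e0 eP] := expectation_sampled eta'0.
  have E0 := eP 0 _; rewrite lexx e0 in E0.
  apply: (@le_trans _ _ (\int[P]_(w in B) limn_einf (fun m => (Y 0 m w)%:E))%E).
    apply: ge0_le_integral_nonmeasurable => w _ //.
    have [D [-> _ D3 _]] := pathwise w.
    apply/lee_subgt0Pr => k k0; rewrite -EFinB; apply: limn_einf_ge.
    by apply: filterS (D3 k k0) => m; rewrite lee_fin.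
  apply: le_trans (@fatou _ _ _ P B mB (fun m w => (Y 0 m w)%:E) _ _) _.
  + by move=> m; apply/measurable_EFinP; apply: measurable_funTS; exact: Ym.
  + by move=> m w _; rewrite lee_fin.
  apply: limn_einf_le; apply: filterS (E0 isT) => m [r rv ->].
  rewrite -EFinD lee_fin -lerBlDl -mulrBl -ler_pdivlMr //.
  exact: le_trans (ler_norm _) rv.
- apply/lee_subgt0Pr => eta eta0.
  have eta'0 : 0 < eta / pi by rewrite divr_gt0.
  have [e e0 eP] := expectation_sampled eta'0.
  pose del := e / 2.
  have del0 : 0 < del by rewrite divr_gt0.
  have E0 := eP del _; rewrite (ltW del0) (_ : del < e) in E0; last by rewrite /del; lra.
  pose L w : \bar R := limn_einf (fun m => (1 - Y del m w)%:E).
  have L0 w : (0 <= L w)%E.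
    by apply: limn_einf_ge; apply: nearW => m; rewrite lee_fin subr_ge0.
  have L1 w : (L w <= 1)%E.
    by apply: limn_einf_le; apply: nearW => m; rewrite lee_fin lerBlDr lerDl.
  have mY m : measurable_fun setT (fun w => (1 - Y del m w)%:E).
    by apply/measurable_EFinP; apply: measurable_funB => //; exact: Ym.
  have mL : measurable_fun setT L.
    rewrite /L /limn_einf; apply: measurableT_comp => //.
    by apply: measurable_fun_limn_esup => m; exact: measurableT_comp.
  have intL : (\int[P]_(w in B) L w <= ((1 - v) * pi + eta)%:E)%E.
    apply: le_trans (@fatou _ _ _ P B mB (fun m w => (1 - Y del m w)%:E) _ _) _.
    + by move=> m; exact: measurable_funTS.
    + by move=> m w _; rewrite lee_fin subr_ge0.
    apply: limn_einf_le; apply: filterS (E0 isT) => m [r rv intY].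
    have iY : P.-integrable B (EFin \o Y del m).
      apply: measurable_bounded_integrable => //.
      - by apply: measurable_funTS; exact: Ym.
      - exists 1; split; first exact: num_real.
        by move=> M M1 w _ /=; rewrite ger0_norm // (le_trans _ (ltW M1)).
    have i1 : P.-integrable B (EFin \o (fun=> 1 : R)).
      apply: measurable_bounded_integrable => //.
      by exists 1; split; [exact: num_real|move=> M M1 w _ /=; rewrite normr1 ltW].
    have -> : (\int[P]_(w in B) (1 - Y del m w)%:E = ((1 - r) * pi)%:E)%E.
      under eq_integral do rewrite EFinB.
      rewrite integralB_EFin // intY.
      rewrite int1 -EFinB.
      by congr EFin; ring.
    rewrite lee_fin -lerBlDl -mulrBl -ler_pdivlMr //.
    apply: le_trans rv; rewrite -normrN; apply: le_trans (ler_norm _); lra.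
  have finL w : L w \is a fin_num.
    by rewrite ge0_fin_numE //; apply: le_lt_trans (L1 w) _; rewrite ltry.
  have LD w : (1 - L w <= discount w)%E.
    have [D [-> _ _ D4]] := pathwise w.
    rewrite leeBlDr // -leeBlDl //.
    apply/lee_subgt0Pr => k k0; rewrite -!EFinB; apply: limn_einf_ge.
    by apply: filterS (D4 del k del0 k0) => m; rewrite lee_fin; lra.
  apply: (@le_trans _ _ (\int[P]_(w in B) (1 - L w))%E); last first.
    apply: ge0_le_integral_nonmeasurable => w _ //.
    by rewrite sube_ge0 // finL.
  have i1 : P.-integrable B (cst 1%E).
    apply: (@measurable_bounded_integrable _ _ _ P (fun=> 1 : R)) => //.
    by exists 1; split; [exact: num_real|move=> M M1 w _ /=; rewrite normr1 ltW].
  have iL : P.-integrable B L.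
    apply: le_integrable i1 => //; first exact: measurable_funTS.
    by move=> w _; rewrite (gee0_abs (L0 w)) /= normr1; exact: L1.
  rewrite integralB // int1.
  have : (\int[P]_(w in B) L w)%E \is a fin_num by exact: integrable_fin_num.
  move: intL; case: (\int[P]_(w in B) L w)%E => // k.
  by rewrite lee_fin => kle _; rewrite -!EFinB lee_fin; lra.
Qed.

Lemma laplace_falling_timeE : laplace_falling_time P eps X level q i = v%:E.
Proof.
rewrite /laplace_falling_time /cond_expectation expectation_discount -/B -/pi.
by rewrite -EFinM mulrC mulfK // gt_eqF.
Qed.

End LaplaceTransform.

Unset Implicit Arguments.

Theorem mainTheorem1 (R : realType) (d : measure_display)
    (Om : measurableType d) (P : probability Om R)
    (lam a gam : bool -> R)
    (lam_gt0 : forall i, 0 < lam i) (gam_gt0 : forall i, 0 < gam i)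
    (ha : a true / gam true < a false / gam false)
    (eps : R -> Om -> bool) (heps : two_state_markov P lam eps)
    (q x : R) (q_gt0 : 0 < q) (hx : a false / gam false < x)
    (X : R -> Om -> R) (hX : ou_bounded_variation a gam eps x X) :
  ((0 < P (in_state eps 0 false))%E ->
   laplace_falling_time P eps X (a false / gam false) q false =
   (lam false / (lam false + q) *
    hypergeom (b0_par gam lam q) (b1_par gam lam q)
      (beta_par gam lam false q + 1) (z_par a gam x))%:E) /\
  ((0 < P (in_state eps 0 true))%E ->
   laplace_falling_time P eps X (a false / gam false) q true =
   (hypergeom (b0_par gam lam q) (b1_par gam lam q)
      (beta_par gam lam false q) (z_par a gam x))%:E).
Proof.
split=> B_gt0.
  exact: (laplace_falling_timeE lam_gt0 gam_gt0 ha heps q_gt0 hx hX (i := false)).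
exact: (laplace_falling_timeE lam_gt0 gam_gt0 ha heps q_gt0 hx hX (i := true)).
Qed.
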